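(* Let $\Gamma$ be a profinite group, let $\mathcal C^+$ denote the groupoid of oriented $\Gamma$-coverings of degree $2$ of $4$-element $\Gamma$-sets, $\mathcal C$ the groupoid of $\Gamma$-coverings of degree $2$ of $4$-element $\Gamma$-sets, $\mathcal F\colon\mathcal C^+\to\mathcal C$ the forgetful functor, $\kappa\colon\mathcal C^+\to\mathcal C^+$ the orientation-switching functor, and $C_1,C_2\colon\mathcal C^+\to\mathcal C$ the spinor functors. Then there exist functors $C_1^+,C_2^+\colon\mathcal C^+\to\mathcal C^+$ with $\mathcal F\circ C_i^+=C_i$ for $i=1,2$, satisfying natural equivalences $$(C_1^+)^3\cong \mathrm{id},\qquad (C_1^+)^2\cong C_2^+,\qquad C_1^+\circ\kappa\cong\kappa\circ C_2^+.$$
   Context: A $\Gamma$-set is a finite set with continuous left $\Gamma$-action. A degree-$2$ covering $\pi\colon Z\to Z_0$ is a $\Gamma$-equivariant map with all fibers of size $2$; $\sigma$ is the involution of $Z$ swapping each fiber. The set of sections $C(Z/Z_0)$ consists of all subsets of $Z$ mapping bijectively onto $Z_0$. For a $\Gamma$-set $X$ with $m\ge2$ elements, $\Delta(X)$ is the two-element $\Gamma$-set of $\mathfrak A_m$-orbits of orderings of $X$; $\delta\colon C(Z/Z_0)\to\Delta(Z)$ sends $\{z_1,\dots,z_4\}$ to the $\mathfrak A_8$-orbit of $(z_1,\dots,z_4,\sigma(z_1),\dots,\sigma(z_4))$. An orientation is a $\Gamma$-isomorphism $\partial\colon\{1,2\}\to\Delta(Z)$ ($\{1,2\}$ with trivial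 action); oriented coverings $(Z/Z_0,\partial)$ have as morphisms the covering isomorphisms compatible with orientations. $\kappa(Z/Z_0,\partial)=(Z/Z_0,\partial\circ\iota)$ where $\iota$ swaps $1,2$. For $|Z_0|=4$, $C_i(Z/Z_0,\partial)=\{\omega\in C(Z/Z_0)\mid\delta(\omega)=\partial(i)\}$ is an $8$-element $\Gamma$-set on which complementation $\omega\mapsto Z\setminus\omega$ is a fixed-point-free involution, hence a degree-$2$ covering of a $4$-element $\Gamma$-set; this defines the functors $C_1,C_2\colon\mathcal C^+\to\mathcal C$. *)

(* Defs.v *)
From HB Require Import structures.
From Stdlib Require Import JMeq.
From mathcomp Require Import all_boot perm.
From mathcomp Require Import boolp classical_sets topology separation_axioms.

Set Implicit Arguments.
Unset Strict Implicit.
Unset Printing Implicit Defensive.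

HB.structure Definition TopGroup := {G of Group G & Topological G}.

Definition profinite (G : TopGroup.type) : Prop :=
  [/\ continuous (fun p : G * G => (p.1 * p.2)%g),
      continuous (fun x : G => (x^-1)%g),
      compact [set: G],
      hausdorff_space G &
      totally_disconnected [set: G]].

(* Finite Gamma-sets.  A Gamma-set is represented by an ambient finite
   type [gT], the finite set [gS] of its elements (a subset of gT) and the
   action [gact] (only its restriction to [gS] matters).  Using an ambient
   type keeps all constructions below total. *)

Record gset (G : TopGroup.type) := GSet {
  gT : finType;
  gS : {set gT};
  gact : G -> gT -> gT }.
Arguments gact {G} g _ _.
Arguments gS {G} g.

(* continuous left action on the (discrete) finite set gS *)
Definition is_gset (G : TopGroup.type) (X : gset G) : Prop :=
  [/\ forall g, {in gS X, forall x, gact X g x \in gS X},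
      {in gS X, forall x, gact X 1%g x = x},
      forall g h, {in gS X, forall x, gact X (g * h)%g x = gact X g (gact X h x)} &
      {in gS X &, forall x y, open (fun g : G => gact X g x = y)}].

Record cov (G : TopGroup.type) := Cov {
  cZ : gset G;
  cZ0 : gset G;
  cpi : gT cZ -> gT cZ0 }.
Arguments cpi {G} c _.

Definition is_cov (G : TopGroup.type) (X : cov G) : Prop :=
  [/\ is_gset (cZ X), is_gset (cZ0 X),
      {in gS (cZ X), forall z, cpi X z \in gS (cZ0 X)},
      forall g, {in gS (cZ X), forall z,
                   cpi X (gact (cZ X) g z) = gact (cZ0 X) g (cpi X z)} &
      {in gS (cZ0 X), forall y, #|[set z in gS (cZ X) | cpi X z == y]| = 2}]
  /\ #|gS (cZ0 X)| = 4.

Definition csig (G : TopGroup.type) (X : cov G) (z : gT (cZ X)) : gT (cZ X) :=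
  odflt z [pick z' in gS (cZ X) | (cpi X z' == cpi X z) && (z' != z)].

Arguments csig {G} X z.

Definition is_section (G : TopGroup.type) (X : cov G) (w : {set gT (cZ X)}) : bool :=
  (w \subset gS (cZ X)) &&
  [forall y in gS (cZ0 X), #|[set z in w | cpi X z == y]| == 1%N].

(* Delta(X): the A_m-orbits of orderings of a finite set S (|S| = m).  *)
(* An ordering is an injective map 'I_m -> S; A_m acts by permuting    *)
(* positions.                                                          *)

Definition ords (m : nat) (T : finType) (S : {set T}) : {set {ffun 'I_m -> T}} :=
  [set f : {ffun 'I_m -> T} | injectiveb f && [forall i, f i \in S]].

Definition oclass (m : nat) (T : finType) (f : {ffun 'I_m -> T})
  : {set {ffun 'I_m -> T}} :=
  [set [ffun i => f (s i)] | s : {perm 'I_m} in [set s : {perm 'I_m} | ~~ odd_perm s]].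

Definition Delta (m : nat) (T : finType) (S : {set T})
  : {set {set {ffun 'I_m -> T}}} :=
  [set oclass f | f in ords m S].

Definition Dmap (m : nat) (T T' : finType) (phi : T -> T') (O : {set {ffun 'I_m -> T}})
  : {set {ffun 'I_m -> T'}} :=
  [set [ffun i => phi (f i)] | f : {ffun 'I_m -> T} in O].

Definition cdelta (G : TopGroup.type) (X : cov G) (w : {set gT (cZ X)})
  : {set {ffun 'I_8 -> gT (cZ X)}} :=
  if [pick z in w] is Some z0 then
    oclass [ffun i : 'I_8 => if (i < 4)%N then nth z0 (enum w) i
                             else csig X (nth z0 (enum w) (i - 4))]
  else finset.set0.

(* Oriented coverings (objects of C^+).  The two-element set {1,2} is  *)
(* 'I_2, with ord0 standing for 1 and ord_max for 2.                   *)

Record ocov (G : TopGroup.type) := OCov {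
  ocov_base : cov G;
  odel : 'I_2 -> {set {ffun 'I_8 -> gT (cZ ocov_base)}} }.

(* odel is a Gamma-isomorphism {1,2} -> Delta(Z), {1,2} with trivial action *)
Definition is_ocov (G : TopGroup.type) (X : ocov G) : Prop :=
  [/\ is_cov (ocov_base X),
      forall i, odel X i \in Delta 8 (gS (cZ (ocov_base X))),
      injective (odel X),
      {in Delta 8 (gS (cZ (ocov_base X))), forall O, exists i, odel X i = O} &
      forall g i, Dmap (gact (cZ (ocov_base X)) g) (odel X i) = odel X i].

Definition swap2 (i : 'I_2) : 'I_2 := if i == ord0 then ord_max else ord0.

Record chom (G : TopGroup.type) (X Y : cov G) := CHom {
  hZ : gT (cZ X) -> gT (cZ Y);
  hZ0 : gT (cZ0 X) -> gT (cZ0 Y) }.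
Arguments hZ {G X Y} c _.
Arguments hZ0 {G X Y} c _.

Definition is_chom (G : TopGroup.type) (X Y : cov G) (h : chom X Y) : Prop :=
  [/\ hZ h @: gS (cZ X) = gS (cZ Y),
      {in gS (cZ X) &, injective (hZ h)},
      hZ0 h @: gS (cZ0 X) = gS (cZ0 Y) &
      {in gS (cZ0 X) &, injective (hZ0 h)}] /\
  [/\ forall g, {in gS (cZ X), forall z, hZ h (gact (cZ X) g z) = gact (cZ Y) g (hZ h z)},
      forall g, {in gS (cZ0 X), forall y, hZ0 h (gact (cZ0 X) g y) = gact (cZ0 Y) g (hZ0 h y)} &
      {in gS (cZ X), forall z, cpi Y (hZ h z) = hZ0 h (cpi X z)}].

Definition is_ohom (G : TopGroup.type) (X Y : ocov G)
    (h : chom (ocov_base X) (ocov_base Y)) : Prop :=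
  is_chom h /\ forall i, Dmap (hZ h) (odel X i) = odel Y i.

(* two morphism data represent the same morphism iff they agree on the
   Gamma-sets *)
Definition chom_eq (G : TopGroup.type) (X Y : cov G) (h k : chom X Y) : Prop :=
  {in gS (cZ X), hZ h =1 hZ k} /\ {in gS (cZ0 X), hZ0 h =1 hZ0 k}.

Definition cid (G : TopGroup.type) (X : cov G) : chom X X := CHom id id.

Definition ccomp (G : TopGroup.type) (X Y W : cov G) (k : chom Y W) (h : chom X Y)
  : chom X W := CHom (hZ k \o hZ h) (hZ0 k \o hZ0 h).

Record ofunctor (G : TopGroup.type) := OFunctor {
  ofo : ocov G -> ocov G;
  ofh : forall X Y : ocov G, chom (ocov_base X) (ocov_base Y) ->
          chom (ocov_base (ofo X)) (ocov_base (ofo Y)) }.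

Definition is_ofunctor (G : TopGroup.type) (F : ofunctor G) : Prop :=
  [/\ forall X, is_ocov X -> is_ocov (ofo F X),
      forall X Y h, is_ocov X -> is_ocov Y -> @is_ohom G X Y h ->
        is_ohom (ofh F h),
      forall X Y h k, is_ocov X -> is_ocov Y -> @is_ohom G X Y h -> is_ohom k ->
        chom_eq h k -> chom_eq (ofh F h) (ofh F k),
      forall X, is_ocov X -> chom_eq (ofh F (cid (ocov_base X))) (cid _) &
      forall X Y W h k, is_ocov X -> is_ocov Y -> is_ocov W ->
        @is_ohom G X Y h -> @is_ohom G Y W k ->
        chom_eq (ofh F (ccomp k h)) (ccomp (ofh F k) (ofh F h))].

Record cfunctor (G : TopGroup.type) := CFunctor {
  cfo : ocov G -> cov G;
  cfh : forall X Y : ocov G, chom (ocov_base X) (ocov_base Y) ->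
          chom (cfo X) (cfo Y) }.

Definition oid (G : TopGroup.type) : ofunctor G :=
  @OFunctor G id (fun X Y h => h).

Definition ocomp (G : TopGroup.type) (A B : ofunctor G) : ofunctor G :=
  @OFunctor G (ofo A \o ofo B) (fun X Y h => ofh A (ofh B h)).

Definition kappa (G : TopGroup.type) : ofunctor G :=
  @OFunctor G (fun X => OCov (odel X \o swap2)) (fun X Y h => h).

Definition forget_after (G : TopGroup.type) (A : ofunctor G) : cfunctor G :=
  @CFunctor G (fun X => ocov_base (ofo A X)) (fun X Y h => ofh A h).

Definition cfunctor_eq (G : TopGroup.type) (A B : cfunctor G) : Prop :=
  (forall X, is_ocov X -> cfo A X = cfo B X) /\
  (forall X Y h, is_ocov X -> is_ocov Y -> @is_ohom G X Y h ->
     JMeq (cfh A h) (cfh B h)).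

Definition onatiso (G : TopGroup.type) (A B : ofunctor G) : Prop :=
  exists (eta : forall X, chom (ocov_base (ofo A X)) (ocov_base (ofo B X)))
         (eps : forall X, chom (ocov_base (ofo B X)) (ocov_base (ofo A X))),
    (forall X, is_ocov X ->
       [/\ is_ohom (eta X), is_ohom (eps X),
           chom_eq (ccomp (eps X) (eta X)) (cid _) &
           chom_eq (ccomp (eta X) (eps X)) (cid _)]) /\
    (forall X Y h, is_ocov X -> is_ocov Y -> @is_ohom G X Y h ->
       chom_eq (ccomp (eta Y) (ofh A h)) (ccomp (ofh B h) (eta X))).

Section Spinor.
Variables (G : TopGroup.type) (i : 'I_2).

Definition spinZ (X : ocov G) : gset G :=
  @GSet G {set gT (cZ (ocov_base X))}
    [set w | is_section w && (cdelta w == odel X i)]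
    (fun g w => gact (cZ (ocov_base X)) g @: w).

Definition spinZ0 (X : ocov G) : gset G :=
  @GSet G {set {set gT (cZ (ocov_base X))}}
    [set [set w; gS (cZ (ocov_base X)) :\: w] | w : {set gT (cZ (ocov_base X))} in gS (spinZ X)]
    (fun g P => [set gact (cZ (ocov_base X)) g @: w | w : {set gT (cZ (ocov_base X))} in P]).

Definition Cspin_obj (X : ocov G) : cov G :=
  @Cov G (spinZ X) (spinZ0 X)
    (fun w => [set w; gS (cZ (ocov_base X)) :\: w]).

Definition Cspin_hom (X Y : ocov G) (h : chom (ocov_base X) (ocov_base Y))
  : chom (Cspin_obj X) (Cspin_obj Y) :=
  @CHom G (Cspin_obj X) (Cspin_obj Y)
    (fun w => hZ h @: w) (fun P => [set hZ h @: w | w : {set gT (cZ (ocov_base X))} in P]).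

Definition Cspin : cfunctor G := @CFunctor G Cspin_obj Cspin_hom.

End Spinor.

(* Main.v *)
Require Import Defs.
From Stdlib Require Import JMeq.
From mathcomp Require Import all_boot perm.
From mathcomp Require Import boolp classical_sets topology separation_axioms.

Set Implicit Arguments.
Unset Strict Implicit.
Unset Printing Implicit Defensive.

(* Choose coordinates on the eight points of Z compatible with the covering, so
   that sections become vectors of F_2^4; reordering a section acts on orderings
   of Z by an even permutation and flipping one coordinate by a transposition,
   so C_1 and C_2 are the even and the odd vectors (the three sets Z, C_1, C_2
   are the weights of the vector and half-spin representations of D4).  Each of
   the three sets maps canonically to the sections of the covering carried by
   any other one: z in Z gives {w in C_i | z in w}, and w' in the other half
   gives {w in C_i | #|w :&: w'| = 3}.  The two families obtained on C_i have
   opposite parities, which orients C_i; labelling them cyclically defines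
   C_i^+, and the same maps Z -> C_1 (C_2^+), C_2 -> C_1 (C_1^+) are the
   natural isomorphisms.  In coordinates everything reduces to parity checks on
   signed 4x4 matrices. *)

(** * Orderings up to even permutations *)

Section OrderingClasses.
Variables (m : nat) (T : finType).
Implicit Types (f g : {ffun 'I_m -> T}) (d : {perm 'I_m}).

Lemma mem_oclass f g :
  reflect (exists2 d, ~~ odd_perm d & g = [ffun i => f (d i)]) (g \in oclass f).
Proof.
apply: (iffP imsetP) => [[d]|[d dP ->]]; first by rewrite inE => dP ->; exists d.
by exists d; rewrite ?inE.
Qed.

Lemma oclass_even f d : ~~ odd_perm d -> oclass [ffun i => f (d i)] = oclass f.
Proof.
move=> dE; apply/setP=> g; apply/mem_oclass/mem_oclass => -[e eE ->].
  exists (e * d)%g; first by rewrite odd_permM (negbTE eE) (negbTE dE).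
  by apply/ffunP=> i; rewrite !ffunE permM.
exists (e * d^-1)%g; first by rewrite odd_permM odd_permV (negbTE eE) (negbTE dE).
by apply/ffunP=> i; rewrite !ffunE permM permKV.
Qed.

Lemma oclass_odd f d : injective f -> odd_perm d ->
  oclass [ffun i => f (d i)] <> oclass f.
Proof.
move=> fI dO /setP/(_ [ffun i => f (d i)]).
have -> : [ffun i => f (d i)] \in oclass [ffun i => f (d i)].
  apply/mem_oclass; exists 1%g; first by rewrite odd_perm1.
  by apply/ffunP=> i; rewrite !ffunE perm1.
move/esym/mem_oclass => [e eE /ffunP fde].
suff de : d = e by rewrite de (negbTE eE) in dO.
by apply/permP=> i; move: (fde i); rewrite !ffunE => /fI.
Qed.

Lemma ordsP (S : {set T}) f :
  reflect (injective f /\ forall i, f i \in S) (f \in ords m S).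
Proof.
rewrite inE; apply: (iffP andP) => -[fI fS]; split.
- exact/injectiveP.
- by move=> i; exact: (forallP fS).
- exact/injectiveP.
- exact/forallP.
Qed.

(** The cardinality hypothesis makes [f] a bijection onto [S], so [d] can be taken as [g] followed
    by the inverse of [f]. *)
Lemma ords_perm (S : {set T}) f g : #|S| = m ->
  f \in ords m S -> g \in ords m S -> exists d, g = [ffun i => f (d i)].
Proof.
move=> Sm /ordsP[fI fS] /ordsP[gI gS].
have fim : f @: [set: 'I_m] = S.
  apply/eqP; rewrite eqEcard card_imset // cardsT card_ord Sm leqnn andbT.
  by apply/fintype.subsetP=> _ /imsetP[i _ ->].
have e i : exists j, f j == g i.
  have: g i \in f @: [set: 'I_m] by rewrite fim.
  by case/imsetP=> j _ ->; exists j.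
pose d i := xchoose (e i); have fd i : f (d i) = g i by exact/eqP/(xchooseP (e i)).
have dI : injective d by move=> i j dij; apply: gI; rewrite -!fd dij.
by exists (perm dI); apply/ffunP=> i; rewrite ffunE permE fd.
Qed.

End OrderingClasses.

Lemma Dmap_oclass (m : nat) (T T' : finType) (h : T -> T')
    (f : {ffun 'I_m -> T}) :
  Dmap h (oclass f) = oclass [ffun i => h (f i)].
Proof.
apply/setP=> g; apply/imsetP/mem_oclass => [[_ /mem_oclass[d dE ->] ->]|[d dE ->]].
  by exists d => //; apply/ffunP=> i; rewrite !ffunE.
exists [ffun i => f (d i)]; first by apply/mem_oclass; exists d.
by apply/ffunP=> i; rewrite !ffunE.
Qed.

Lemma split_lshift (m n : nat) (a : 'I_m) : split (lshift n a) = inl a.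
Proof. exact: (unsplitK (inl a)). Qed.

Lemma split_rshift (m n : nat) (a : 'I_n) : split (rshift m a) = inr a.
Proof. exact: (unsplitK (inr a)). Qed.

Lemma lrshift8 (a b : 'I_4) : (lshift 4 a == rshift 4 b :> 'I_8) = false.
Proof. exact: eq_lrshift. Qed.

Lemma ord8P (i : 'I_8) :
  (exists a : 'I_4, i = lshift 4 a) \/ (exists a : 'I_4, i = rshift 4 a).
Proof.
by case: (split_ordP (i : 'I_(4 + 4))) => a ->; [left|right]; exists a.
Qed.

(** * Simultaneous permutation of two copies of an index set *)

Section DoublePerm.
Variables (n : nat) (s : {perm 'I_n}).

Let left_fun (i : 'I_(n + n)) : 'I_(n + n) :=
  match split i with inl a => lshift n (s a) | inr a => rshift n a end.
Let swap_fun (i : 'I_(n + n)) : 'I_(n + n) :=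
  match split i with inl a => rshift n a | inr a => lshift n a end.

Lemma left_fun_inj : injective left_fun.
Proof.
move=> i j; rewrite /left_fun -{2}(splitK i) -{2}(splitK j).
case: (split i) => a; case: (split j) => b //= /eqP;
  by rewrite ?eq_shift // => /eqP; try move/perm_inj; move=> ->.
Qed.

Lemma swap_fun_inj : injective swap_fun.
Proof.
move=> i j; rewrite /swap_fun -{2}(splitK i) -{2}(splitK j).
by case: (split i) => a; case: (split j) => b //= /eqP;
  rewrite ?eq_shift // => /eqP->.
Qed.

(* The second factor is a conjugate of the first one, so the product is even. *)
Definition double_perm : {perm 'I_(n + n)} :=
  (perm left_fun_inj * perm left_fun_inj ^ perm swap_fun_inj)%g.

Lemma double_perm_even : ~~ odd_perm double_perm.
Proof. by rewrite odd_permM odd_permJ addbb. Qed.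

(** Reordering a section reorders its image under the involution in the same way, so this is how the
    ordering inside [cdelta] depends on the enumeration of the section. *)
Lemma double_permE (i : 'I_(n + n)) :
  double_perm i =
  match split i with inl a => lshift n (s a) | inr a => rshift n (s a) end.
Proof.
have L a : perm left_fun_inj (lshift n a) = lshift n (s a).
  by rewrite permE /left_fun split_lshift.
have R a : perm left_fun_inj (rshift n a) = rshift n a.
  by rewrite permE /left_fun split_rshift.
have SL a : perm swap_fun_inj (lshift n a) = rshift n a.
  by rewrite permE /swap_fun split_lshift.
have SR a : perm swap_fun_inj (rshift n a) = lshift n a.
  by rewrite permE /swap_fun split_rshift.
rewrite -{1}(splitK i) permM; case: (split i) => a /=.
  by rewrite L -[in LHS]SR permJ R SR.
by rewrite R -SL permJ L SL.
Qed.

End DoublePerm.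

(** * Frames of coverings *)

Definition bits := (bool * bool * bool * bool)%type.

Definition bit (v : bits) (i : 'I_4) : bool :=
  let: (a, b, c, d) := v in
  match val i with 0 => a | 1 => b | 2 => c | _ => d end.

Definition mkbits (g : 'I_4 -> bool) : bits :=
  (g (Ordinal (isT : 0 < 4)), g (Ordinal (isT : 1 < 4)),
   g (Ordinal (isT : 2 < 4)), g (Ordinal (isT : 3 < 4))).

Definition par (v : bits) : bool :=
  let: (a, b, c, d) := v in a (+) b (+) c (+) d.

(** Four minus the Hamming distance; it becomes the size of the intersection of two sections in
    [card_secI]. The explicit sum lets finite checks compute. *)
Definition agree (v w : bits) : nat :=
  let: (a, b, c, d) := v in let: (a', b', c', d') := w in
  (a == a') + (b == b') + (c == c') + (d == d').

(** With bits read as signs, this is multiplication of the vector by a sign; [addc v true] describes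
    the complementary section ([setD_sec]). *)
Definition addc (v : bits) (e : bool) : bits :=
  let: (a, b, c, d) := v in (a (+) e, b (+) e, c (+) e, d (+) e).

Lemma bit_mkbits g i : bit (mkbits g) i = g i.
Proof.
by case: i => [[|[|[|[|i]]]] Hi] //=; congr g; apply: val_inj.
Qed.

Lemma bits_ext v w : (forall i, bit v i = bit w i) -> v = w.
Proof.
case: v w => [[[a b] c] d] [[[a' b'] c'] d'] H.
have := H (Ordinal (isT : 0 < 4)); have := H (Ordinal (isT : 1 < 4)).
have := H (Ordinal (isT : 2 < 4)); have := H (Ordinal (isT : 3 < 4)).
by move=> /= -> -> -> ->.
Qed.

Lemma bit_addc v e i : bit (addc v e) i = bit v i (+) e.
Proof. by case: v => [[[a b] c] d]; case: i => [[|[|[|[|i]]]] Hi]. Qed.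

Lemma agreeE v w : agree v w = #|[set i | bit v i == bit w i]|.
Proof.
rewrite -sum1dep_card big_mkcond /= !big_ord_recl big_ord0 /=.
by case: v w => [[[a b] c] d] [[[a' b'] c'] d'] /=;
  do 4 (case: (_ == _)) .
Qed.

Section Frames.
Variable G : TopGroup.type.
Implicit Types (X Y : cov G) (v w : bits).

(** The index [i] runs over the points of the base and [b] over the two points of a fibre. The group
    action does not enter, so group elements can be handled as maps carrying frames to frames. *)
Definition frame X (f : 'I_4 -> bool -> gT (cZ X)) : Prop :=
  [/\ forall i b, f i b \in gS (cZ X),
      {in gS (cZ X), forall z, exists i b, z = f i b},
      forall i j b c, (cpi X (f i b) == cpi X (f j c)) = (i == j),
      forall i b, f i (~~ b) != f i b &
      forall y, (y \in gS (cZ0 X)) = [exists i, y == cpi X (f i false)]].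

Definition sec (T : finType) (f : 'I_4 -> bool -> T) v : {set T} :=
  [set f i (bit v i) | i : 'I_4].

(** The layout is the one of [cdelta]: the section in the first four positions, the opposite points
    in the last four. *)
Definition ordr (T : finType) (f : 'I_4 -> bool -> T) v : {ffun 'I_8 -> T} :=
  [ffun i : 'I_(4 + 4) =>
    match split i with inl a => f a (bit v a) | inr a => f a (~~ bit v a) end].

Lemma imset_sec (T T' : finType) (h : T -> T') (f : 'I_4 -> bool -> T) v :
  h @: sec f v = sec (fun i b => h (f i b)) v.
Proof. by rewrite -imset_comp. Qed.

Section OneFrame.
Variables (X : cov G) (f : 'I_4 -> bool -> gT (cZ X)).
Hypothesis fF : frame f.

Lemma frame_inj i j b c : (f i b == f j c) = (i == j) && (b == c).
Proof.
case: fF => _ _ fpi fN _; apply/eqP/andP => [e|[/eqP-> /eqP->] //].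
have ij : i == j by rewrite -(fpi _ _ b c) e.
split=> //; move: e; rewrite (eqP ij).
case: b c => -[] // /eqP; first by rewrite (negbTE (fN j false)).
by rewrite (negbTE (fN j true)).
Qed.

Lemma frame_injP i j b c : f i b = f j c -> i = j /\ b = c.
Proof. by move/eqP; rewrite frame_inj => /andP[/eqP-> /eqP->]. Qed.

Lemma mem_sec v i b : (f i b \in sec f v) = (bit v i == b).
Proof.
apply/imsetP/eqP => [[j _ /frame_injP[-> ->]] //|<-]; by exists i.
Qed.

Lemma sec_sub v : sec f v \subset gS (cZ X).
Proof. by case: fF => fS _ _ _ _; apply/fintype.subsetP=> _ /imsetP[i _ ->]. Qed.

Lemma sec_inj v w : sec f v = sec f w -> v = w.
Proof.
move=> e; apply: bits_ext => i; apply/esym/eqP.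
by rewrite -mem_sec -e mem_sec.
Qed.

(** Since the frame exhausts the carrier, a section given by a predicate is recognized by testing
    the frame points only; [Zsec] and [Ssec] are computed this way. *)
Lemma set_sec (P : pred (gT (cZ X))) v :
  (forall i b, P (f i b) = (bit v i == b)) ->
  [set z in gS (cZ X) | P z] = sec f v.
Proof.
move=> Pf; case: (fF) => fS fO _ _ _; apply/setP=> z; rewrite inE.
have [zS|zS] := boolP (z \in gS (cZ X)).
  by case: (fO z zS) => i [b ->]; rewrite mem_sec Pf.
by apply/esym/negbTE; apply: contra zS; apply: (fintype.subsetP (sec_sub v)).
Qed.

Lemma setD_sec v : gS (cZ X) :\: sec f v = sec f (addc v true).
Proof.
rewrite -(@set_sec (fun z => z \notin sec f v) (addc v true)) => [|i b].
  by apply/setP=> z; rewrite !inE andbC.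
by rewrite mem_sec bit_addc addbT; case: (bit v i); case: b.
Qed.

Lemma card_secI v w : #|sec f v :&: sec f w| = agree v w.
Proof.
rewrite agreeE -(card_imset _ (_ : injective (fun i => f i (bit v i)))).
  apply/eq_card=> z; apply/setIP/imsetP => [[/imsetP[i _ ->]]|[i]].
    by rewrite mem_sec => wv; exists i; rewrite // inE eq_sym.
  by rewrite inE => vw ->; rewrite !mem_sec eqxx eq_sym.
by move=> i j /frame_injP[].
Qed.

Lemma is_section_sec v : is_section (sec f v).
Proof.
case: (fF) => fS fO fpi fN f0; rewrite /is_section sec_sub /=.
apply/forallP=> y; apply/implyP; rewrite f0 => /existsP[i /eqP->].
rewrite (_ : finset _ = [set f i (bit v i)]) ?cards1 //.
apply/setP=> z; rewrite !inE; apply/andP/eqP => [[/imsetP[j _ ->]]|->].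
  by rewrite fpi => /eqP->.
by rewrite mem_sec eqxx fpi eqxx.
Qed.

Lemma section_sec (w : {set gT (cZ X)}) : is_section w -> exists v, w = sec f v.
Proof.
case: (fF) => fS fO fpi fN f0 /andP[wS /forallP wy].
(* A section meets each fibre once, so it suffices to record whether it contains the point labelled
   [true]. *)
exists (mkbits (fun i => f i true \in w)).
rewrite -(@set_sec (mem w) (mkbits _)) => [|i b].
  by apply/setP=> z; rewrite inE andb_idl //; move: z; apply/fintype.subsetP.
rewrite bit_mkbits; have := wy (cpi X (f i false)); rewrite f0.
have -> /= : [exists j, cpi X (f i false) == cpi X (f j false)].
  by apply/existsP; exists i.
move/cards1P=> [z0 /setP e].
have et := e (f i true); have ef := e (f i false); move: et ef.
rewrite !inE !fpi eqxx !andbT.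
have : exists b0, z0 = f i b0.
  have := e z0; rewrite !inE eqxx => /andP[z0w].
  case: (fO z0 (fintype.subsetP wS _ z0w)) => j [b0 ->].
  by rewrite fpi => /eqP->; exists b0.
by case=> b0 ->; rewrite !frame_inj eqxx /=; case: b; case: b0 => e1 e2; rewrite ?e1 ?e2.
Qed.

Lemma csig_frame i b : csig X (f i b) = f i (~~ b).
Proof.
case: (fF) => fS fO fpi fN _; rewrite /csig; case: pickP => [z|/(_ (f i (~~ b)))].
  case/and3P=> zS; case: (fO z zS) => j [c ->]; rewrite fpi => /eqP->.
  by rewrite frame_inj eqxx /=; case: b c => -[].
by rewrite fS fpi eqxx fN.
Qed.

Lemma card_frame : #|gS (cZ X)| = 8.
Proof.
case: (fF) => fS fO fpi fN _.
have -> : gS (cZ X) = (fun p : 'I_4 * bool => f p.1 p.2) @: [set: 'I_4 * bool].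
  apply/setP=> z; apply/idP/imsetP => [/fO[i [b ->]]|[p _ ->] //].
  by exists (i, b); rewrite ?inE.
rewrite card_imset ?cardsT ?card_prod ?card_ord ?card_bool //.
by move=> [i b] [j c] /= /frame_injP[-> ->].
Qed.

Lemma ordr_ords v : ordr f v \in ords 8 (gS (cZ X)).
Proof.
case: (fF) => fS _ _ _ _; apply/ordsP; split=> [i j|i]; last first.
  by rewrite ffunE; case: split => a; apply: fS.
rewrite !ffunE -{2}(splitK (i : 'I_(4 + 4))) -{2}(splitK (j : 'I_(4 + 4))).
case: (split _) => a; case: (split _) => b /frame_injP[-> ] //;
  by case: (bit v b).
Qed.

(** [enum] may list the section in another order than the frame does, but both halves are then
    permuted alike, which is an even permutation of the eight positions. The point [z0] is only the
    default of [nth]. *)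
Lemma cdelta_sec v : cdelta (sec f v) = oclass (ordr f v).
Proof.
rewrite /cdelta; case: pickP => [z0 z0w|/(_ (f ord0 (bit v ord0)))]; last first.
  by rewrite mem_sec eqxx.
have sz : size (enum (sec f v)) = 4.
  rewrite -cardE -[sec f v]finset.setIid card_secI.
  by case: v {z0w} => [[[[] []] []] []].
have e (a : 'I_4) : exists j, nth z0 (enum (sec f v)) a == f j (bit v j).
  have: nth z0 (enum (sec f v)) a \in sec f v by rewrite -mem_enum mem_nth ?sz.
  by case/imsetP=> j _ ->; exists j.
pose s a := xchoose (e a).
have fs (a : 'I_4) : nth z0 (enum (sec f v)) a = f (s a) (bit v (s a)).
  exact/eqP/(xchooseP (e a)).
have sI : injective s.
  move=> a b sab; apply/ord_inj/eqP.
  by rewrite -(nth_uniq z0 _ _ (enum_uniq (sec f v))) ?sz // !fs sab.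
rewrite -[RHS](oclass_even _ (double_perm_even (perm sI))); congr oclass.
apply/ffunP=> i; rewrite !ffunE double_permE.
have [[a ->]|[a ->]] := ord8P i.
  by rewrite !split_lshift permE /= ltn_ord fs.
by rewrite !split_rshift permE /= addKn fs csig_frame.
Qed.

Definition flip v k := mkbits (fun i => bit v i (+) (i == k)).

(** Changing one coordinate exchanges the two points of fibre [k], which stand in positions [k] and
    [4 + k]. *)
Lemma ordr_flip v k : ordr f (flip v k) =
  [ffun i => ordr f v (tperm (lshift 4 k : 'I_8) (rshift 4 k : 'I_8) i)].
Proof.
apply/ffunP=> i; rewrite !ffunE.
have [[a ->]|[a ->]] := ord8P i.
  rewrite split_lshift bit_mkbits; have [->|ak] := eqVneq a k.
    by rewrite tpermL split_rshift addbT.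
  rewrite tpermD ?split_lshift ?addbF //.
    by apply: contra ak => /eqP e; rewrite (@lshift_inj 4 4 _ _ e).
  by rewrite eq_sym lrshift8.
rewrite split_rshift bit_mkbits; have [->|ak] := eqVneq a k.
  by rewrite tpermR split_lshift addbT negbK.
rewrite tpermD ?split_rshift ?addbF ?lrshift8 //.
by apply: contra ak => /eqP e; rewrite (@rshift_inj 4 4 _ _ e).
Qed.

Lemma oclass_flip2 v j k :
  oclass (ordr f (flip (flip v j) k)) = oclass (ordr f v).
Proof.
rewrite !ordr_flip.
set s := tperm _ _; set t := tperm _ _.
rewrite -(oclass_even (ordr f v) (_ : ~~ odd_perm (t * s)%g)).
  by congr oclass; apply/ffunP=> i; rewrite !ffunE permM.
by rewrite odd_permM !odd_tperm !lrshift8.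
Qed.

Lemma oclass_par v w :
  (oclass (ordr f v) == oclass (ordr f w)) = (par v == par w).
Proof.
(* Two flips give an even permutation, so the nonzero bits can be carried from the last coordinate
   towards the first without changing the class. *)
have red u : oclass (ordr f u) = oclass (ordr f (par u, false, false, false)).
  pose p k l u := flip (flip u k) l.
  have E k l x : oclass (ordr f x) = oclass (ordr f (p k l x)).
    by rewrite oclass_flip2.
  pose i0 : 'I_4 := Ordinal (isT : 0 < 4); pose i1 : 'I_4 := Ordinal (isT : 1 < 4).
  pose i2 : 'I_4 := Ordinal (isT : 2 < 4); pose i3 : 'I_4 := Ordinal (isT : 3 < 4).
  case: u => [[[a b] c] d].
  have -> : oclass (ordr f (a, b, c, d)) = oclass (ordr f (a, b, c (+) d, false)).
    by case: d; rewrite ?addbF // (E i3 i2) /p /flip /mkbits /= !addbF.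
  have -> : oclass (ordr f (a, b, c (+) d, false))
          = oclass (ordr f (a, b (+) (c (+) d), false, false)).
    by case: (c (+) d); rewrite ?addbF // (E i2 i1) /p /flip /mkbits /= !addbF.
  have -> : oclass (ordr f (a, b (+) (c (+) d), false, false))
          = oclass (ordr f (a (+) (b (+) (c (+) d)), false, false, false)).
    by case: (b (+) _); rewrite ?addbF // (E i1 i0) /p /flip /mkbits /= !addbF.
  by rewrite /par -!addbA.
rewrite (red v) (red w).
(* The two remaining normal forms differ by one flip, an odd permutation. *)
have ne : oclass (ordr f (true, false, false, false)) <>
          oclass (ordr f (false, false, false, false)).
  have -> : (true, false, false, false) = flip (false, false, false, false) ord0 by [].
  rewrite ordr_flip; apply: oclass_odd.
    by case/ordsP: (ordr_ords (false, false, false, false)).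
  by rewrite odd_tperm lrshift8.
apply/eqP/eqP => [|-> //].
by case: (par v); case: (par w) => // e; case: ne.
Qed.

Lemma Delta_sec O : O \in Delta 8 (gS (cZ X)) -> exists v, O = oclass (ordr f v).
Proof.
case/imsetP=> g gO ->.
pose v0 : bits := (false, false, false, false).
have [d ->] := ords_perm card_frame (ordr_ords v0) gO.
have [dO|dE] := boolP (odd_perm d); last by exists v0; rewrite oclass_even.
(* One flip compensates for the odd [d]: [t * d^-1] is then even. *)
exists (flip v0 ord0); rewrite ordr_flip.
set t := tperm _ _.
rewrite -(oclass_even [ffun i => _ (d i)] (_ : ~~ odd_perm (t * d^-1)%g)).
  by congr oclass; apply/ffunP=> i; rewrite !ffunE permM permKV.
by rewrite odd_permM odd_permV dO odd_tperm lrshift8.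
Qed.

Lemma sec_Delta v : oclass (ordr f v) \in Delta 8 (gS (cZ X)).
Proof. by apply/imsetP; exists (ordr f v) => //; apply: ordr_ords. Qed.

Lemma Dmap_sec (T' : finType) (h : gT (cZ X) -> T') v :
  Dmap h (oclass (ordr f v)) = oclass (ordr (fun i b => h (f i b)) v).
Proof.
rewrite Dmap_oclass; congr oclass; apply/ffunP=> i; rewrite !ffunE.
by case: split.
Qed.

Lemma frame_fibre y : y \in gS (cZ0 X) ->
  #|[set z in gS (cZ X) | cpi X z == y]| = 2.
Proof.
case: (fF) => fS fO fpi fN f0; rewrite f0 => /existsP[i /eqP->].
rewrite (_ : finset _ = [set f i true; f i false]).
  by rewrite cards2 (fN i false).
apply/setP=> z; rewrite !inE; apply/andP/orP => [[/fO[j [b ->]]]|].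
  by rewrite fpi => /eqP->; case: b; rewrite eqxx; [left|right].
by case=> /eqP->; rewrite fS fpi.
Qed.

Lemma card_frame0 : #|gS (cZ0 X)| = 4.
Proof.
case: (fF) => fS fO fpi fN f0.
have -> : gS (cZ0 X) = (fun i => cpi X (f i false)) @: 'I_4.
  apply/setP=> y; rewrite f0; apply/existsP/imsetP => [[i /eqP->]|[i _ ->]].
    by exists i.
  by exists i.
rewrite card_imset ?card_ord // => i j /eqP; by rewrite fpi => /eqP.
Qed.

End OneFrame.

End Frames.

(** * Positively oriented frames and maps preserving them *)

Section OrientedFrames.
Variable G : TopGroup.type.

(** Enumerate the base and order the two points of each fibre arbitrarily. *)
Lemma cov_frame (X : cov G) : is_cov X -> exists f, @frame G X f.
Proof.
case=> -[_ _ piS _ fib] c4.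
pose y (i : 'I_4) := enum_val (cast_ord (esym c4) i).
have yS i : y i \in gS (cZ0 X) by apply: enum_valP.
have yI i j : (y i == y j) = (i == j).
  by rewrite /y (inj_eq enum_val_inj) (inj_eq (@cast_ord_inj _ _ _)).
have yO z : z \in gS (cZ0 X) -> exists i, z = y i.
  move=> zS; exists (cast_ord c4 (enum_rank_in zS z)).
  by rewrite /y cast_ordK enum_rankK_in.
have /boolp.choice[p pP] : forall i, exists p : gT (cZ X) * gT (cZ X),
    p.1 != p.2 /\
    [set z in gS (cZ X) | cpi X z == y i] = [set p.1; p.2].
  move=> i; have /eqP/cards2P[a [b [ab e]]] := fib _ (yS i).
  by exists (a, b); split.
pose f i b := if b then (p i).1 else (p i).2; exists f.
have fP i b : (f i b \in gS (cZ X)) /\ cpi X (f i b) = y i.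
  have : f i b \in [set z in gS (cZ X) | cpi X z == y i].
    by rewrite (pP i).2 !inE /f; case: b; rewrite eqxx ?orbT.
  by rewrite inE => /andP[-> /eqP->].
split.
- by move=> i b; case: (fP i b).
- move=> z zS; have [i zi] := yO _ (piS z zS); exists i.
  have : z \in [set z in gS (cZ X) | cpi X z == y i] by rewrite inE zS zi eqxx.
  by rewrite (pP i).2 !inE => /orP[] /eqP->; [exists true|exists false].
- by move=> i j b c; rewrite !(fP _ _).2 yI.
- by move=> i [] /=; have [pi _] := pP i; rewrite /f // eq_sym.
- move=> z; apply/idP/existsP => [/yO[i ->]|[i /eqP->]].
    by exists i; rewrite (fP _ _).2.
  by rewrite (fP _ _).2.
Qed.

Definition b2o (b : bool) : 'I_2 := if b then ord_max else ord0.

Lemma b2oP (i : 'I_2) : exists b, i = b2o b.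
Proof.
by case: i => [[|[|i]] Hi] //; [exists false|exists true]; apply: val_inj.
Qed.

(** These are the positively oriented coordinates: in them the first spinor set consists of the even
    vectors and the second of the odd ones ([sec_spin]). *)
Definition oframe (X : ocov G) (f : 'I_4 -> bool -> gT (cZ (ocov_base X))) :=
  frame f /\ forall v, oclass (ordr f v) = odel X (b2o (par v)).
Arguments oframe : clear implicits.

Lemma odel_b2o_inj (X : ocov G) f : oframe X f -> injective (odel X).
Proof.
case=> fF fO i j; have [b ->] := b2oP i; have [c ->] := b2oP j.
have e a : odel X (b2o a) = oclass (ordr f (a, false, false, false)).
  by rewrite fO /par !addbF.
by rewrite !e => /eqP; rewrite oclass_par // /par !addbF => /eqP->.
Qed.

Lemma frame_flip (X : cov G) f k : frame f ->
  @frame G X (fun i b => f i (b (+) (i == k))).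
Proof.
case=> fS fO fpi fN f0; split=> //.
- move=> z /fO[i [b ->]]; exists i, (b (+) (i == k)).
  by rewrite -addbA addbb addbF.
- by move=> i b; rewrite addNb; apply: fN.
- move=> y; rewrite f0; apply: eq_existsb => i; congr (y == _).
  by apply/eqP; rewrite fpi.
Qed.

Lemma ocov_oframe (X : ocov G) : is_ocov X -> exists f, oframe X f.
Proof.
case=> cX dS dI dO dG.
(* There are only two classes, so the class of the zero vector determines the orientation of the
   whole frame. *)
have fin f : frame f ->
    oclass (ordr f (false, false, false, false)) = odel X ord0 -> oframe X f.
  move=> fF f0; split=> // v; have [pv|pv] := boolP (par v); last first.
    by rewrite /= -f0; apply/eqP; rewrite oclass_par // (negbTE pv).
  have [i di] := dO _ (sec_Delta fF v).
  have [[] ib] := b2oP i; rewrite ib in di; first by rewrite -di.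
  by move/eqP: di; rewrite -f0 oclass_par // pv.
have [f fF] := cov_frame cX.
have [i di] := dO _ (sec_Delta fF (false, false, false, false)).
have [[] ib] := b2oP i; last by exists f; apply: fin; rewrite // -di ib.
(* A negatively oriented frame is corrected by exchanging the two points of one fibre. *)
exists (fun i b => f i (b (+) (i == ord0))); apply: fin; first exact: frame_flip.
have [j dj] := dO _ (sec_Delta fF (true, false, false, false)).
have [[] jb] := b2oP j.
  have /eqP := etrans (esym dj) (etrans (congr1 (odel X) (etrans jb (esym ib))) di).
  by rewrite oclass_par.
rewrite -[odel X ord0]/(odel X (b2o false)) -jb dj; congr oclass.
apply/ffunP=> k; rewrite !ffunE.
by case: split => -[[|[|[|[|a]]]] Ha].
Qed.

Lemma is_ocov_frame (X : ocov G) f : is_cov (ocov_base X) -> oframe X f ->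
  (forall g i, Dmap (gact (cZ (ocov_base X)) g) (odel X i) = odel X i) ->
  is_ocov X.
Proof.
move=> cX fF dG; split=> //; last 2 first.
- exact: odel_b2o_inj fF.
- case: fF => fF fO O /(Delta_sec fF)[v ->]; exists (b2o (par v)).
  by rewrite fO.
- move=> i; have [b ->] := b2oP i; case: fF => fF fO.
  have -> : b = par (b, false, false, false) by rewrite /par !addbF.
  by rewrite -fO sec_Delta.
Qed.

(** Equivariance is left out so that the action of a single group element and the upper map of a
    morphism are both instances ([gact_bij], [chom_bij]). *)
Definition bij_cov (X Y : cov G) (h : gT (cZ X) -> gT (cZ Y)) :=
  [/\ h @: gS (cZ X) = gS (cZ Y), {in gS (cZ X) &, injective h} &
      {in gS (cZ X) &, forall z z',
        (cpi Y (h z) == cpi Y (h z')) = (cpi X z == cpi X z')}].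

Lemma cov_pi_onto (X : cov G) y : is_cov X -> y \in gS (cZ0 X) ->
  exists2 z, z \in gS (cZ X) & cpi X z = y.
Proof.
case=> -[_ _ _ _ fib] _ yS.
have : [set z in gS (cZ X) | cpi X z == y] != finset.set0.
  by rewrite -card_gt0 fib.
by case/set0Pn=> z; rewrite inE => /andP[zS /eqP<-]; exists z.
Qed.

Lemma frame_image (X Y : cov G) (h : gT (cZ X) -> gT (cZ Y)) f :
  is_cov Y -> bij_cov h -> frame f -> @frame G Y (fun i b => h (f i b)).
Proof.
move=> cY [hS hI hpi] [fS fO fpi fN f0].
have hfS i b : h (f i b) \in gS (cZ Y) by rewrite -hS imset_f.
have hO z : z \in gS (cZ Y) -> exists i b, z = h (f i b).
  by rewrite -hS => /imsetP[x /fO[i [b ->]] ->]; exists i, b.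
split=> //.
- by move=> i j b c; rewrite hpi.
- by move=> i b; apply/eqP => /hI e; move/eqP: (fN i b); apply; apply: e.
- move=> y; apply/idP/existsP => [/(cov_pi_onto cY)[z /hO[i [b ->]] <-]|[i /eqP->]].
    by exists i; rewrite hpi // fpi.
  by case: cY => -[_ _ piS _ _] _; apply: piS.
Qed.

Lemma gactK (X : gset G) g x : is_gset X -> x \in gS X ->
  gact X g (gact X g^-1%g x) = x.
Proof.
by case=> _ a1 aM _ xS; rewrite -aM // mulgV a1.
Qed.

Lemma gact_inj (X : gset G) g : is_gset X -> {in gS X &, injective (gact X g)}.
Proof.
case=> _ a1 aM _ x y xS yS e.
by rewrite -[x]a1 // -[y]a1 // -(mulVg g) !aM // e.
Qed.

Lemma gact_bij (X : cov G) g : is_cov X -> @bij_cov X X (gact (cZ X) g).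
Proof.
case=> -[zX z0X piS piG fib] c4; split.
- apply/setP=> z; apply/imsetP/idP => [[x xS ->]|zS].
    by case: zX => aS *; apply: aS.
  by exists (gact (cZ X) g^-1%g z); rewrite ?gactK //; case: zX => aS *; apply: aS.
- exact: gact_inj.
- move=> z z' zS zS'; rewrite !piG //; apply/eqP/eqP => [|-> //].
  by apply: gact_inj => //; apply: piS.
Qed.

Lemma chom_bij (X Y : cov G) (h : chom X Y) : is_cov X -> is_chom h ->
  bij_cov (hZ h).
Proof.
case=> -[_ _ piS _ _] _ [[hS hI h0S h0I] [_ _ hpi]]; split=> // z z' zS zS'.
rewrite !hpi //; apply/eqP/eqP => [|-> //].
by apply: h0I; apply: piS.
Qed.

Lemma oframe_image (X Y : ocov G) (h : gT (cZ (ocov_base X)) -> gT (cZ (ocov_base Y))) f :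
  is_cov (ocov_base Y) -> bij_cov h -> (forall i, Dmap h (odel X i) = odel Y i) ->
  oframe X f -> oframe Y (fun i b => h (f i b)).
Proof.
move=> cY hB hD [fF fO]; split; first exact: frame_image hB fF.
by move=> v; rewrite -hD -fO Dmap_sec.
Qed.

(** The group acts trivially on the two labels of an orientation, so each of its elements preserves
    positivity of frames. *)
Lemma gact_oframe (X : ocov G) g f : is_ocov X -> oframe X f ->
  oframe X (fun i b => gact (cZ (ocov_base X)) g (f i b)).
Proof.
move=> oX; apply: oframe_image; case: oX => // cX _ _ _ _; exact: gact_bij.
Qed.

Lemma ohom_oframe (X Y : ocov G) h f : is_ocov X -> is_ocov Y ->
  is_ohom h -> oframe X f -> oframe Y (fun i b => hZ h (f i b)).
Proof.
move=> [cX _ _ _ _] [cY _ _ _ _] [hh hD].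
by apply: oframe_image => //; apply: chom_bij.
Qed.

End OrientedFrames.
Arguments oframe {G} X f.

(** * The oriented spinor functors *)

Section SpinFrames.
Variable G : TopGroup.type.
Implicit Types (X Y : ocov G) (c : bool).

Definition Zsec c X (z : gT (cZ (ocov_base X)))
    : {set gT (cZ (Cspin_obj (b2o c) X))} :=
  [set w in gS (spinZ (b2o c) X) | z \in w].

(** Sections of opposite parities meet in one or three points, and complementing one of them
    exchanges these two cases; so exactly one of [w] and its complement is selected. *)
Definition Ssec c X (w' : {set gT (cZ (ocov_base X))})
    : {set gT (cZ (Cspin_obj (b2o c) X))} :=
  [set w in gS (spinZ (b2o c) X) | #|w :&: w'| == 3].

(* [false] and [true] index C_1 and C_2.  The value does not depend on the
   elements picked: all [Ssec] have the same parity, all [Zsec] the other. *)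
Definition ospin_del c X (j : 'I_2)
    : {set {ffun 'I_8 -> gT (cZ (Cspin_obj (b2o c) X))}} :=
  if j == b2o c then
    if [pick w' in gS (spinZ (b2o (~~ c)) X)] is Some w'
    then @cdelta G (Cspin_obj (b2o c) X) (Ssec c w') else finset.set0
  else
    if [pick z in gS (cZ (ocov_base X))] is Some z
    then @cdelta G (Cspin_obj (b2o c) X) (Zsec c z) else finset.set0.

Definition ospin c X : ocov G := @OCov G (Cspin_obj (b2o c) X) (@ospin_del c X).

(* The last two conditions compute the parities of the sections [Zsec] and
   [Ssec] in the frame [spin_frame f N]. *)
Definition spin_matrix c (N : 'I_4 -> bits) :=
  [/\ forall j, par (N j) = c,
      forall v, par v = c -> exists j b, v = addc (N j) b,
      forall j k b b', addc (N j) b = addc (N k) b' -> j = k,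
      forall k, par (mkbits (fun j => bit (N j) k)) = ~~ c &
      forall v, par v = ~~ c -> par (mkbits (fun j => agree (N j) v != 3)) = c].

Definition spin_frame (T : finType) (f : 'I_4 -> bool -> T) (N : 'I_4 -> bits)
    (j : 'I_4) (b : bool) : {set T} := sec f (addc (N j) b).

Lemma par_addc v b : par (addc v b) = par v.
Proof. by case: v => [[[[] []] []] []]; case: b. Qed.

Lemma addc0 v : addc v false = v.
Proof. by case: v => [[[[] []] []] []]. Qed.

Lemma addcD v b b' : addc (addc v b) b' = addc v (b (+) b').
Proof. by apply: bits_ext => i; rewrite !bit_addc addbA. Qed.

(** For opposite parities the agreement is 1 or 3, and complementing [v] swaps the two values. *)
Lemma agree_addc v w b : par w = ~~ par v ->
  (agree (addc v b) w == 3) = ((agree v w != 3) == b).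
Proof.
by case: b v w => [] [[[[] []] []] []] [[[[] []] []] []].
Qed.

Section OneSpinFrame.
Variables (X : ocov G) (f : 'I_4 -> bool -> gT (cZ (ocov_base X))).
Hypothesis fO : oframe X f.

Lemma cdelta_oframe v : cdelta (sec f v) = odel X (b2o (par v)).
Proof. by case: fO => fF <-; apply: cdelta_sec. Qed.

Lemma sec_spin c v : (sec f v \in gS (spinZ (b2o c) X)) = (par v == c).
Proof.
rewrite inE is_section_sec ?cdelta_oframe; last by case: fO.
rewrite (inj_eq (odel_b2o_inj fO)).
by case: (par v); case: c.
Qed.

Lemma spinP c w : w \in gS (spinZ (b2o c) X) -> exists2 v, par v = c & w = sec f v.
Proof.
move=> wS.
have /andP[] : is_section w && (cdelta w == odel X (b2o c)) by rewrite inE in wS.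
case/(section_sec (proj1 fO)) => v wv _; exists v => //; apply/eqP.
by rewrite -sec_spin -wv.
Qed.

Lemma spin_pi c v : cpi (Cspin_obj (b2o c) X) (sec f v) =
  [set sec f v; sec f (addc v true)].
Proof. by rewrite /= (setD_sec (proj1 fO)). Qed.

Variables (c : bool) (N : 'I_4 -> bits).
Hypothesis NG : spin_matrix c N.

(** The first three conditions of [spin_matrix] say that the rows of [N] represent the vectors of
    parity [c] up to complement, each pair once. *)
Lemma spin_frameP : @frame G (Cspin_obj (b2o c) X) (spin_frame f N).
Proof.
case: NG => Np NO NI _ _; have fF := proj1 fO; split.
- by move=> j b; rewrite sec_spin par_addc Np.
- by move=> w /spinP[v /NO[j [b ->]] ->]; exists j, b.
- move=> i j b b'; rewrite !spin_pi !addcD addbT.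
  apply/eqP/eqP => [/setP/(_ (sec f (addc (N i) b)))|->].
    rewrite !inE eqxx => /esym/orP[] /eqP/(sec_inj fF); exact: NI.
  by case: b b' => -[] //=; rewrite finset.setUC.
- move=> j b; apply/eqP => /(sec_inj fF) e.
  have := congr1 (fun v => bit v ord0) e; rewrite /= !bit_addc.
  by case: bit; case: b {e}.
- move=> y; apply/imsetP/existsP => [[w wS ->]|[i /eqP->]].
    case/spinP: (wS) => v /NO[j [b ->]] ->; exists j.
    rewrite /spin_frame !spin_pi (setD_sec fF) !addcD addbT.
    by case: b => //=; rewrite finset.setUC.
  by exists (spin_frame f N i false) => //; rewrite sec_spin par_addc Np.
Qed.

(** In the new coordinates a point of fibre [k] becomes column [k] of [N], up to sign. *)
Lemma Zsec_frame k b : Zsec c (f k b) =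
  sec (spin_frame f N) (addc (mkbits (fun j => bit (N j) k)) b).
Proof.
apply: (set_sec spin_frameP) => j e.
rewrite (mem_sec (proj1 fO)) !bit_addc bit_mkbits.
by case: bit; case: e; case: b.
Qed.

Lemma Ssec_frame v : par v = ~~ c -> Ssec c (sec f v) =
  sec (spin_frame f N) (mkbits (fun j => agree (N j) v != 3)).
Proof.
move=> pv; case: (NG) => Np _ _ _ _.
apply: (set_sec spin_frameP) => j e.
by rewrite (card_secI (proj1 fO)) bit_mkbits agree_addc // Np.
Qed.

(** Whatever elements [ospin_del] picks, the last two conditions of [spin_matrix] give parity [c] to
    the class from [Ssec] and the other parity to the class from [Zsec]. *)
Lemma spin_oframe : oframe (ospin c X) (spin_frame f N).
Proof.
have FF := spin_frameP; split=> // v; rewrite /= /ospin_del.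
case: (NG) => _ _ _ Nk NS; have [_ fO' _ _ _] := proj1 fO.
have -> : (b2o (par v) == b2o c) = (par v == c) by case: (par v); case: c.
have E u : par v = par u ->
    oclass (ordr (spin_frame f N) v) = oclass (ordr (spin_frame f N) u).
  by move=> e; apply/eqP; rewrite (oclass_par FF) e.
have [pv|pv] := eqVneq (par v) c.
  (* The vector exhibited has parity [~~ c], so the other half is not empty and the pick cannot
     fail. *)
  case: pickP => [w' /spinP[v' pv' ->]|/(_ (sec f (~~ c, false, false, false)))].
    by rewrite Ssec_frame // (cdelta_sec FF); apply: E; rewrite NS.
  by rewrite sec_spin /par !addbF eqxx.
case: pickP => [z /fO'[k [b ->]]|/(_ (f ord0 true))]; last first.
  by case: (proj1 fO) => ->.
rewrite Zsec_frame // (cdelta_sec FF); apply: E.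
by rewrite par_addc Nk; move: pv; case: (par v); case: c.
Qed.

End OneSpinFrame.
End SpinFrames.

(** * Explicit matrices and functoriality of the oriented spinor constructions *)

Section SpinFunctor.
Variable G : TopGroup.type.
Implicit Types (X Y : ocov G) (c : bool).

(* Signed 4x4 matrices whose rows are the coordinates of four half-spin
   weights of D4, pairwise neither equal nor opposite; the signs are chosen so
   that the frame they define is positively oriented. *)
Definition spin_mx c (j : 'I_4) : bits :=
  if c then
    match val j with
    | 0 => (false, true, true, true)
    | 1 => (false, true, false, false)
    | 2 => (false, false, true, false)
    | _ => (false, false, false, true)
    end
  else
    match val j with
    | 0 => (true, true, true, true)
    | 1 => (false, false, true, true)
    | 2 => (false, true, false, true)
    | _ => (false, true, true, false)
    end.

Definition all4 (P : pred 'I_4) :=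
  [&& P (Ordinal (isT : 0 < 4)), P (Ordinal (isT : 1 < 4)),
      P (Ordinal (isT : 2 < 4)) & P (Ordinal (isT : 3 < 4))].

Lemma all4P (P : pred 'I_4) : all4 P -> forall i, P i.
Proof.
by move=> /and4P[? ? ? ?] [[|[|[|[|i]]]] Hi] //;
  rewrite (bool_irrelevance Hi isT).
Qed.

Definition allbits (P : pred bits) :=
  all (fun a => all (fun b => all (fun c => all (fun d => P (a, b, c, d))
    [:: true; false]) [:: true; false]) [:: true; false]) [:: true; false].

Lemma allbitsP (P : pred bits) : allbits P -> forall v, P v.
Proof.
move=> H [[[a b] c] d].
have B (x : bool) : x \in [:: true; false] by case: x.
by move/allP/(_ a (B a))/allP/(_ b (B b))/allP/(_ c (B c))/allP/(_ d (B d)): H.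
Qed.

(** A decision procedure over four indices and sixteen vectors, to be run by [vm_compute] on
    concrete matrices. *)
Definition spin_matrixb c (N : 'I_4 -> bits) :=
  [&& all4 (fun j => par (N j) == c),
      allbits (fun v => (par v == c) ==>
        ~~ all4 (fun j => (v != addc (N j) true) && (v != addc (N j) false))),
      all4 (fun j => all4 (fun k => (val j == val k) ||
         (N j != N k) && (N j != addc (N k) true))),
      all4 (fun k => par (mkbits (fun j => bit (N j) k)) == ~~ c) &
      allbits (fun v => (par v == ~~ c) ==>
         (par (mkbits (fun j => agree (N j) v != 3)) == c))].

Lemma spin_matrixP c N : spin_matrixb c N -> spin_matrix c N.
Proof.
case/and5P=> /all4P H1 /allbitsP H2 /all4P H3 /all4P H4 /allbitsP H5; split.
- by move=> j; apply/eqP.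
- move=> v /eqP pv; move: (H2 v); rewrite pv /= => H.
  apply: contraPP H => H; apply/negP; rewrite negbK.
  by apply/and4P; split; apply/andP; split; apply/eqP => e; apply: H;
    rewrite e; eexists; eexists.
- move=> j k b b' e; have /orP[/eqP/val_inj //|] := all4P (H3 j) k.
  have -> : N j = addc (N k) (b' (+) b).
    by rewrite -addcD -e addcD addbb addc0.
  by case: (_ (+) _); rewrite ?addc0 eqxx ?andbF.
- by move=> k; apply/eqP.
- by move=> v /eqP pv; apply/eqP; move: (H5 v); rewrite pv.
Qed.

Lemma spin_mxP c : spin_matrix c (spin_mx c).
Proof. by apply: spin_matrixP; case: c; vm_compute. Qed.

Lemma imset_spin_frame (T T' : finType) (h : T -> T') f N :
  (fun j b => h @: spin_frame f N j b) = spin_frame (fun i b => h (f i b)) N.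
Proof. by apply/funext => j; apply/funext => b; rewrite imset_sec. Qed.

Section Image.
Variables (X Y : ocov G) (h : gT (cZ (ocov_base X)) -> gT (cZ (ocov_base Y))).
Variables (f : 'I_4 -> bool -> gT (cZ (ocov_base X))).
Hypotheses (fO : oframe X f) (hfO : oframe Y (fun i b => h (f i b))).

(** The map [h] only has to carry an oriented frame to an oriented frame, so this serves both for
    equivariance ([gact_oframe]) and for functoriality ([ohom_oframe]). *)
Lemma spin_image c w : w \in gS (spinZ (b2o c) X) -> h @: w \in gS (spinZ (b2o c) Y).
Proof. by case/(spinP fO) => v pv ->; rewrite imset_sec (sec_spin hfO) pv. Qed.

Lemma spin_pi_image c w : w \in gS (spinZ (b2o c) X) ->
  cpi (Cspin_obj (b2o c) Y) (h @: w) =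
  [set h @: u | u : {set gT (cZ (ocov_base X))} in cpi (Cspin_obj (b2o c) X) w].
Proof.
case/(spinP fO) => v pv ->.
by rewrite (spin_pi fO) imset_sec (spin_pi hfO) imsetU1 imset_set1 !imset_sec.
Qed.

Lemma spin_oframe_image c : oframe (ospin c X) (spin_frame f (spin_mx c)) /\
  oframe (ospin c Y) (fun j b => h @: spin_frame f (spin_mx c) j b).
Proof.
split; first exact: spin_oframe (spin_mxP c).
rewrite imset_spin_frame; exact: (spin_oframe hfO (spin_mxP c)).
Qed.

(** The coordinates given by [Zsec_frame] depend on the matrix alone, so they agree in the frame [f]
    and in its image under [h]. *)
Lemma Zsec_image c z : z \in gS (cZ (ocov_base X)) ->
  [set h @: w | w : {set gT (cZ (ocov_base X))} in Zsec c z] = Zsec c (h z).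
Proof.
have [_ onto _ _ _] := proj1 fO; case/onto => k [b ->].
rewrite (Zsec_frame fO (spin_mxP c)) (Zsec_frame hfO (spin_mxP c)).
by rewrite imset_sec imset_spin_frame.
Qed.

Lemma Ssec_image c w : w \in gS (spinZ (b2o (~~ c)) X) ->
  [set h @: u | u : {set gT (cZ (ocov_base X))} in Ssec c w] = Ssec c (h @: w).
Proof.
case/(spinP fO) => v pv ->; rewrite imset_sec.
rewrite (Ssec_frame fO (spin_mxP c) pv) (Ssec_frame hfO (spin_mxP c) pv).
by rewrite imset_sec imset_spin_frame.
Qed.

End Image.

Lemma spin_sub c X w : w \in gS (spinZ (b2o c) X) -> w \subset gS (cZ (ocov_base X)).
Proof. by rewrite inE => /andP[/andP[]]. Qed.

Lemma spin0_sub c X P w : P \in gS (spinZ0 (b2o c) X) -> w \in P ->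
  w \subset gS (cZ (ocov_base X)).
Proof.
case/imsetP=> u uS ->; rewrite !inE => /orP[] /eqP->; last exact: finset.subsetDl.
exact: spin_sub uS.
Qed.

(** Continuity gives a neighbourhood for each point, and finitely many of them intersect in one.
    This yields continuity of the action on sets of points and on sets of sets. *)
Lemma near_gact (X : gset G) g : is_gset X ->
  nbhs g (fun g' => {in gS X, forall x, gact X g' x = gact X g x}).
Proof.
move=> [aS a1 aM aO].
have H x : nbhs g (fun g' => x \in gS X -> gact X g' x = gact X g x).
  have [xS|xS] := boolP (x \in gS X); last first.
    by apply: (@filterS _ _ _ setT) filterT => g' _.
  have := aO _ _ xS (aS g _ xS); rewrite openE => /(_ g erefl).
  by apply: filterS => g' e _.
by apply: filterS (filter_forall (nbhs_filter g) H) => g' e x; apply: e.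
Qed.

Lemma spin_gset c X : is_ocov X -> is_gset (spinZ (b2o c) X).
Proof.
move=> oX; have [f fO] := ocov_oframe oX.
have gX : is_gset (cZ (ocov_base X)) by case: oX => -[[]].
case: (gX) => aS a1 aM aO; split.
- by move=> g w; apply: (spin_image fO (gact_oframe g oX fO)).
- move=> w /spin_sub/fintype.subsetP wS.
  rewrite -[RHS]imset_id; apply: eq_in_imset => z /wS; exact: a1.
- move=> g h w /spin_sub/fintype.subsetP wS /=.
  rewrite -imset_comp; apply: eq_in_imset => z /wS; exact: aM.
- move=> w w' /spin_sub/fintype.subsetP wS _; rewrite openE => g /= e.
  apply: filterS (near_gact g gX) => g' e'; rewrite -e.
  by apply: eq_in_imset => z /wS; apply: e'.
Qed.

Lemma spin0_gset c X : is_ocov X -> is_gset (spinZ0 (b2o c) X).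
Proof.
move=> oX; have [f fO] := ocov_oframe oX.
have gX : is_gset (cZ (ocov_base X)) by case: oX => -[[]].
case: (gX) => aS a1 aM aO; split.
- move=> g _ /imsetP[w wS ->] /=.
  rewrite -[[set w; _]]/(cpi (Cspin_obj (b2o c) X) w).
  rewrite -(spin_pi_image fO (gact_oframe g oX fO)) //.
  by apply: imset_f; apply: (spin_image fO (gact_oframe g oX fO) wS).
- move=> P /spin0_sub PS /=.
  rewrite -[RHS]imset_id; apply: eq_in_imset => w /PS/fintype.subsetP wS.
  rewrite -[RHS]imset_id; apply: eq_in_imset => z /wS; exact: a1.
- move=> g h P /spin0_sub PS /=.
  rewrite -imset_comp; apply: eq_in_imset => w /PS/fintype.subsetP wS /=.
  rewrite -imset_comp; apply: eq_in_imset => z /wS; exact: aM.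
- move=> P P' /spin0_sub PS _; rewrite openE => g /= e.
  apply: filterS (near_gact g gX) => g' e'; rewrite -e.
  apply: eq_in_imset => w /PS/fintype.subsetP wS.
  by apply: eq_in_imset => z /wS; apply: e'.
Qed.

Lemma spin_cov c X : is_ocov X -> is_cov (Cspin_obj (b2o c) X).
Proof.
move=> oX; have [f fO] := ocov_oframe oX.
have FF := spin_frameP fO (spin_mxP c); split; last exact: card_frame0 FF.
split.
- exact: spin_gset.
- exact: spin0_gset.
- by move=> w wS; apply: imset_f.
- move=> g w wS; exact: (spin_pi_image fO (gact_oframe g oX fO) wS).
- by move=> y; apply: frame_fibre FF _.
Qed.

Lemma ospin_ocov c X : is_ocov X -> is_ocov (ospin c X).
Proof.
move=> oX; have [f fO] := ocov_oframe oX.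
have FO := spin_oframe fO (spin_mxP c).
apply: (@is_ocov_frame G (ospin c X) _ (spin_cov c oX) FO) => g i.
have [b ->] := b2oP i.
have -> : b = par (b, false, false, false) by rewrite /par !addbF.
have [_ gO] := spin_oframe_image fO (gact_oframe g oX fO) c.
(* The translate of the spinor frame by [g] is again positively oriented, so [g] fixes both
   classes. *)
rewrite -{1}(proj2 FO) Dmap_sec -(proj2 gO); exact: erefl.
Qed.

(** Bijectivity and orientation are read off the frames; equivariance on the base follows from that
    upstairs because the projection is onto. *)
Lemma is_ohom_frame X Y (k : chom (ocov_base X) (ocov_base Y)) f :
  is_ocov X -> is_ocov Y -> oframe X f -> oframe Y (fun i b => hZ k (f i b)) ->
  (forall g, {in gS (cZ (ocov_base X)), forall z,
     hZ k (gact (cZ (ocov_base X)) g z) = gact (cZ (ocov_base Y)) g (hZ k z)}) ->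
  {in gS (cZ (ocov_base X)), forall z,
     cpi (ocov_base Y) (hZ k z) = hZ0 k (cpi (ocov_base X) z)} ->
  is_ohom k.
Proof.
move=> oX oY fO kO kG kpi.
have [cX _ _ _ _] := oX; have [cY _ _ _ _] := oY.
case: (fO) => fF fd; case: (kO) => kF kd.
case: (fF) => fS fS' fpi fN f0; case: (kF) => kS kS' kfpi kN k0.
have [[zX z0X piS piG _] _] := cX; have [[_ _ _ piGY _] _] := cY.
split; last first.
  move=> i; have [b ->] := b2oP i.
  have -> : b = par (b, false, false, false) by rewrite /par !addbF.
  by rewrite -fd Dmap_sec kd.
have y0 y : y \in gS (cZ0 (ocov_base X)) -> exists i, y = cpi (ocov_base X) (f i false).
  by rewrite f0 => /existsP[i /eqP->]; exists i.
split; split=> //.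
- apply/setP=> z; apply/imsetP/idP => [[_ /fS'[i [b ->]] ->] //|/kS'[i [b ->]]].
  by exists (f i b).
- by move=> _ _ /fS'[i [b ->]] /fS'[j [b' ->]] /(frame_injP kF)[-> ->].
- apply/setP=> y; rewrite k0; apply/imsetP/existsP => [[_ /y0[i ->] ->]|[i /eqP->]].
    by exists i; rewrite -kpi.
  by exists (cpi (ocov_base X) (f i false)); rewrite ?kpi // piS.
- move=> _ _ /y0[i ->] /y0[j ->]; rewrite -!kpi // => /eqP.
  by rewrite kfpi => /eqP->.
- move=> g _ /y0[i ->]; rewrite -piG // -!kpi //; last by case: zX => aS *; apply: aS.
  by rewrite kG // piGY.
Qed.

Definition ospinF c : ofunctor G :=
  @OFunctor G (ospin c) (fun X Y h => Cspin_hom (b2o c) h).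

Lemma ospinF_functor c : is_ofunctor (ospinF c).
Proof.
split.
- exact: ospin_ocov.
- move=> X Y h oX oY hh; have [f fO] := ocov_oframe oX.
  have hfO := ohom_oframe oX oY hh fO.
  have [FO kO] := spin_oframe_image fO hfO c.
  apply: (is_ohom_frame _ _ FO) => //=; try exact: ospin_ocov.
  + move=> g w /spin_sub/fintype.subsetP wS /=; rewrite -!imset_comp.
    by apply: eq_in_imset => z /wS zS /=; case: hh => -[_ [hG _ _]] _; apply: hG.
  + by move=> w wS; apply: (spin_pi_image fO hfO wS).
- move=> X Y h k oX oY hh kk [hk _].
  split=> [w /spin_sub/fintype.subsetP wS|P /spin0_sub PS] /=.
    by apply: eq_in_imset => z /wS; apply: hk.
  apply: eq_in_imset => w /PS/fintype.subsetP wS.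
  by apply: eq_in_imset => z /wS; apply: hk.
- move=> X oX; split=> [w _|P _] /=; first exact: imset_id.
  by rewrite -[RHS]imset_id; apply: eq_imset => w; apply: imset_id.
- move=> X Y W h k *; split=> [w _|P _] /=; first exact: imset_comp.
  by rewrite -imset_comp; apply: eq_imset => w; apply: imset_comp.
Qed.

End SpinFunctor.

(** * Natural isomorphisms on oriented coverings *)

Section NaturalIsomorphisms.
Variable G : TopGroup.type.
Implicit Types (X Y : ocov G) (A B : ofunctor G).

Lemma chom_in (X Y : cov G) (h : chom X Y) z : is_chom h ->
  z \in gS (cZ X) -> hZ h z \in gS (cZ Y).
Proof. by case=> -[<- _ _ _] _ zS; apply: imset_f. Qed.

(** The projection is onto, so a morphism is determined by its upper map. *)
Lemma chom_eqZ (X Y : cov G) (h k : chom X Y) : is_cov X -> is_chom h -> is_chom k ->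
  {in gS (cZ X), hZ h =1 hZ k} -> chom_eq h k.
Proof.
move=> cX [_ [_ _ hpi]] [_ [_ _ kpi]] hk; split=> // y /(cov_pi_onto cX)[z zS <-].
by rewrite -hpi // hk // kpi.
Qed.

Lemma is_ohom_id X : is_ohom (Defs.cid (ocov_base X)).
Proof.
split=> [|i].
  by split; split=> //=; try exact: imset_id; move=> x y _ _.
rewrite /Dmap -[RHS]imset_id; apply: eq_imset => f.
by apply/ffunP => j; rewrite ffunE.
Qed.

Lemma is_ohom_comp X Y W (k : chom (ocov_base Y) (ocov_base W))
    (h : chom (ocov_base X) (ocov_base Y)) :
  is_ohom h -> is_ohom k -> is_ohom (ccomp k h).
Proof.
move=> [hh hD] [kk kD]; split; last first.
  move=> i; rewrite -kD -hD /Dmap -imset_comp; apply: eq_imset => f.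
  by apply/ffunP => j; rewrite !ffunE.
have [[hS hI h0S h0I] [hG h0G hpi]] := hh.
have [[kS kI k0S k0I] [kG k0G kpi]] := kk.
have hin z : z \in gS (cZ (ocov_base X)) -> hZ h z \in gS (cZ (ocov_base Y)).
  by rewrite -hS; apply: imset_f.
have h0in z : z \in gS (cZ0 (ocov_base X)) -> hZ0 h z \in gS (cZ0 (ocov_base Y)).
  by rewrite -h0S; apply: imset_f.
split; split.
- by rewrite imset_comp hS.
- by move=> x y xS yS /= /kI e; apply: hI => //; apply: e; apply: hin.
- by rewrite imset_comp h0S.
- by move=> x y xS yS /= /k0I e; apply: h0I => //; apply: e; apply: h0in.
- by move=> g z zS /=; rewrite hG // kG // hin.
- by move=> g z zS /=; rewrite h0G // k0G // h0in.
- by move=> z zS /=; rewrite kpi ?hin // hpi.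
Qed.

(* [onatiso] with components required on genuine oriented coverings only. *)
Definition natiso_on A B : Prop :=
  exists (eta : forall X, is_ocov X -> chom (ocov_base (ofo A X)) (ocov_base (ofo B X)))
         (eps : forall X, is_ocov X -> chom (ocov_base (ofo B X)) (ocov_base (ofo A X))),
    (forall X (oX : is_ocov X),
       [/\ is_ohom (eta X oX), is_ohom (eps X oX),
           chom_eq (ccomp (eps X oX) (eta X oX)) (Defs.cid _) &
           chom_eq (ccomp (eta X oX) (eps X oX)) (Defs.cid _)]) /\
    (forall X Y h (oX : is_ocov X) (oY : is_ocov Y), is_ohom h ->
       chom_eq (ccomp (eta Y oY) (ofh A h)) (ccomp (ofh B h) (eta X oX))).

Lemma ofunctor_ocov A X : is_ofunctor A -> is_ocov X -> is_ocov (ofo A X).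
Proof. by case=> H *; apply: H. Qed.

Lemma ofunctor_cov A X : is_ofunctor A -> is_ocov X -> is_cov (ocov_base (ofo A X)).
Proof. by move=> HA /(ofunctor_ocov HA)[]. Qed.

Lemma ofunctor_ohom A X Y (h : chom (ocov_base X) (ocov_base Y)) :
  is_ofunctor A -> is_ocov X -> is_ocov Y -> is_ohom h -> is_ohom (ofh A h).
Proof. by case=> _ H *; apply: H. Qed.

Lemma natiso_on_sym A B : is_ofunctor A -> is_ofunctor B ->
  natiso_on A B -> natiso_on B A.
Proof.
move=> HA HB [eta [eps [inv nat]]]; exists eps, eta; split.
  by move=> X oX; have [] := inv X oX.
move=> X Y h oX oY hh.
have [etaX epsX _ [KX _]] := inv X oX; have [_ epsY [KY _] _] := inv Y oY.
have [nZ _] := nat X Y h oX oY hh.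
have Ah := ofunctor_ohom HA oX oY hh; have Bh := ofunctor_ohom HB oX oY hh.
apply: chom_eqZ; first exact: ofunctor_cov.
- by case: (is_ohom_comp Bh epsY).
- by case: (is_ohom_comp epsX Ah).
move=> z zS /=; have eS := chom_in (proj1 epsX) zS.
have /= e1 := KX _ zS; have /= e2 := nZ _ eS.
have /= e3 := KY _ (chom_in (proj1 Ah) eS).
by rewrite -[in LHS]e1 -e2 e3.
Qed.

Lemma natiso_on_trans A B C : is_ofunctor A -> is_ofunctor B -> is_ofunctor C ->
  natiso_on A B -> natiso_on B C -> natiso_on A C.
Proof.
move=> HA HB HC [eta [eps [inv nat]]] [eta' [eps' [inv' nat']]].
exists (fun X oX => ccomp (eta' X oX) (eta X oX)).
exists (fun X oX => ccomp (eps X oX) (eps' X oX)); split.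
  move=> X oX; have [h1 h2 [K1 _] [K2 _]] := inv X oX.
  have [h1' h2' [K1' _] [K2' _]] := inv' X oX.
  have e1 := is_ohom_comp h1 h1'; have e2 := is_ohom_comp h2' h2.
  split=> //; apply: chom_eqZ.
  + exact: ofunctor_cov.
  + by case: (is_ohom_comp e1 e2).
  + by case: (is_ohom_id (ofo A X)).
  + by move=> z zS; have /= -> := K1' _ (chom_in (proj1 h1) zS); apply: K1.
  + exact: ofunctor_cov.
  + by case: (is_ohom_comp e2 e1).
  + by case: (is_ohom_id (ofo C X)).
  + by move=> z zS; have /= -> := K2 _ (chom_in (proj1 h2') zS); apply: K2'.
move=> X Y h oX oY hh.
have [h1 _ _ _] := inv X oX; have [h1' _ _ _] := inv' X oX.
have [k1 _ _ _] := inv Y oY; have [k1' _ _ _] := inv' Y oY.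
have Ah := ofunctor_ohom HA oX oY hh; have Ch := ofunctor_ohom HC oX oY hh.
apply: chom_eqZ; first exact: ofunctor_cov.
- by case: (is_ohom_comp Ah (is_ohom_comp k1 k1')).
- by case: (is_ohom_comp (is_ohom_comp h1 h1') Ch).
move=> z zS /=; have [n1 _] := nat X Y h oX oY hh; have [n2 _] := nat' X Y h oX oY hh.
by have /= -> := n1 _ zS; have /= -> := n2 _ (chom_in (proj1 h1) zS).
Qed.

Lemma ocomp_functor A B : is_ofunctor A -> is_ofunctor B -> is_ofunctor (ocomp A B).
Proof.
move=> HA HB; have [A1 A2 A3 A4 A5] := HA; have [B1 B2 B3 B4 B5] := HB; split=> /=.
- by move=> X oX; apply/A1/B1.
- by move=> X Y h oX oY hh; apply: A2; [apply: B1|apply: B1|apply: B2].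
- move=> X Y h k oX oY hh kk hk.
  by apply: A3; [apply: B1|apply: B1|apply: B2|apply: B2|apply: B3].
- move=> X oX; have oBX := B1 _ oX.
  have idB := is_ohom_id (ofo B X); have BB := B2 _ _ _ oX oX (is_ohom_id X).
  have [e1 e2] := A3 _ _ _ _ oBX oBX BB idB (B4 _ oX); have [e3 e4] := A4 _ oBX.
  by split=> z zS; rewrite ?e1 ?e2 ?e3 ?e4.
- move=> X Y W h k oX oY oW hh kk.
  have oBX := B1 _ oX; have oBY := B1 _ oY; have oBW := B1 _ oW.
  have Bh := B2 _ _ _ oX oY hh; have Bk := B2 _ _ _ oY oW kk.
  have Bkh := B2 _ _ _ oX oW (is_ohom_comp hh kk).
  have [e1 e2] := A3 _ _ _ _ oBX oBW Bkh (is_ohom_comp Bh Bk)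
    (B5 _ _ _ _ _ oX oY oW hh kk).
  have [e3 e4] := A5 _ _ _ _ _ oBX oBY oBW Bh Bk.
  by split=> z zS; rewrite ?e1 ?e2 ?e3 ?e4.
Qed.

Lemma natiso_on_compr A A' B : is_ofunctor B ->
  natiso_on A A' -> natiso_on (ocomp A B) (ocomp A' B).
Proof.
move=> HB [eta [eps [inv nat]]].
exists (fun X oX => eta (ofo B X) (ofunctor_ocov HB oX)).
exists (fun X oX => eps (ofo B X) (ofunctor_ocov HB oX)); split=> [X oX|X Y h oX oY hh].
  exact: inv.
by apply: nat; apply: ofunctor_ohom.
Qed.

Lemma natiso_on_compl A B B' : is_ofunctor A -> is_ofunctor B -> is_ofunctor B' ->
  natiso_on B B' -> natiso_on (ocomp A B) (ocomp A B').
Proof.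
move=> HA HB HB' [eta [eps [inv nat]]]; have [A1 A2 A3 A4 A5] := HA.
have [B1 B2 _ _ _] := HB; have [B1' B2' _ _ _] := HB'.
exists (fun X oX => ofh A (eta X oX)); exists (fun X oX => ofh A (eps X oX)); split.
  move=> X oX; have [h1 h2 K1 K2] := inv X oX.
  have oB := B1 _ oX; have oB' := B1' _ oX.
  split; [exact: A2|exact: A2| |].
  + have [e1 e2] := A3 _ _ _ _ oB oB (is_ohom_comp h1 h2) (is_ohom_id _) K1.
    have [e3 e4] := A5 _ _ _ _ _ oB oB' oB h1 h2; have [e5 e6] := A4 _ oB.
    by split=> z zS; rewrite -?e3 -?e4 // ?e1 ?e2 // ?e5 ?e6.
  + have [e1 e2] := A3 _ _ _ _ oB' oB' (is_ohom_comp h2 h1) (is_ohom_id _) K2.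
    have [e3 e4] := A5 _ _ _ _ _ oB' oB oB' h2 h1; have [e5 e6] := A4 _ oB'.
    by split=> z zS; rewrite -?e3 -?e4 // ?e1 ?e2 // ?e5 ?e6.
move=> X Y h oX oY hh.
have oBX := B1 _ oX; have oBX' := B1' _ oX; have oBY := B1 _ oY; have oBY' := B1' _ oY.
have [h1 _ _ _] := inv X oX; have [k1 _ _ _] := inv Y oY.
have Bh := B2 _ _ _ oX oY hh; have Bh' := B2' _ _ _ oX oY hh.
have [e1 e2] := A3 _ _ _ _ oBX oBY' (is_ohom_comp Bh k1) (is_ohom_comp h1 Bh')
  (nat X Y h oX oY hh).
have [e3 e4] := A5 _ _ _ _ _ oBX oBY oBY' Bh k1.
have [e5 e6] := A5 _ _ _ _ _ oBX oBX' oBY' h1 Bh'.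
by split=> z zS; rewrite -?e3 -?e4 // ?e1 ?e2 // ?e5 ?e6.
Qed.

(** The base map lifts a point arbitrarily; [chom_of_pi] shows that the lift does not matter. The
    point [y0] only supplies a value where no lift exists. *)
Definition chom_of (X Y : cov G) (y0 : gT (cZ Y)) (h : gT (cZ X) -> gT (cZ Y)) :
    chom X Y :=
  @CHom G X Y h (fun y => if [pick z in gS (cZ X) | cpi X z == y] is Some z
                  then cpi Y (h z) else cpi Y y0).

Lemma chom_of_pi (X Y : cov G) (y0 : gT (cZ Y)) (h : gT (cZ X) -> gT (cZ Y)) f z :
  frame f -> frame (fun i b => h (f i b)) -> z \in gS (cZ X) ->
  cpi Y (h z) = hZ0 (chom_of y0 h) (cpi X z).
Proof.
move=> [fS fO fpi _ _] [_ _ hpi _ _] zS /=.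
case: pickP => [z'|/(_ z)]; last by rewrite zS eqxx.
case/andP=> /fO[i [b ->]]; case: (fO _ zS) => j [c ->]; rewrite fpi => /eqP->.
by apply/eqP; rewrite hpi.
Qed.

Lemma ocov_inhabited X : is_ocov X -> exists z, z \in gS (cZ (ocov_base X)).
Proof. by case/ocov_oframe=> f [[fS _ _ _ _] _]; exists (f ord0 true). Qed.

Definition ocov_point X (oX : is_ocov X) : gT (cZ (ocov_base X)) :=
  xchoose (ocov_inhabited oX).

(** Frames give bijectivity and orientation, and [chom_of] gives the base map, so an upper map that
    is equivariant and natural suffices. *)
Lemma natiso_on_frames A B (HA : is_ofunctor A) (HB : is_ofunctor B)
    (e : forall X, gT (cZ (ocov_base (ofo A X))) -> gT (cZ (ocov_base (ofo B X)))) :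
  (forall X, is_ocov X -> exists f,
     oframe (ofo A X) f /\ oframe (ofo B X) (fun i b => e X (f i b))) ->
  (forall X g, is_ocov X -> {in gS (cZ (ocov_base (ofo A X))), forall z,
     e X (gact (cZ (ocov_base (ofo A X))) g z) =
     gact (cZ (ocov_base (ofo B X))) g (e X z)}) ->
  (forall X Y h, is_ocov X -> is_ocov Y -> @is_ohom G X Y h ->
     {in gS (cZ (ocov_base (ofo A X))), forall z,
        e Y (hZ (ofh A h) z) = hZ (ofh B h) (e X z)}) ->
  natiso_on A B.
Proof.
move=> efr eG enat.
pose e' X (x0 : gT (cZ (ocov_base (ofo A X)))) z' :=
  odflt x0 [pick z in gS (cZ (ocov_base (ofo A X))) | e X z == z'].
pose eta X (oX : is_ocov X) :=
  chom_of (ocov_point (ofunctor_ocov HB oX)) (e X).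
pose eps X (oX : is_ocov X) :=
  chom_of (ocov_point (ofunctor_ocov HA oX)) (e' X (ocov_point (ofunctor_ocov HA oX))).
have inv X (oX : is_ocov X) : [/\ is_ohom (eta X oX), is_ohom (eps X oX),
    chom_eq (ccomp (eps X oX) (eta X oX)) (Defs.cid _) &
    chom_eq (ccomp (eta X oX) (eps X oX)) (Defs.cid _)].
  have oA := ofunctor_ocov HA oX; have oB := ofunctor_ocov HB oX.
  have [f [fO eO]] := efr X oX; have [[fF fd] [eF ed]] := (fO, eO).
  have [fS fS' _ _ _] := fF; have [eS eS' _ _ _] := eF.
  have e'K x0 i b : e' X x0 (e X (f i b)) = f i b.
    rewrite /e'; case: pickP => [z|/(_ (f i b))]; last by rewrite fS eqxx.
    by case/andP=> /fS'[j [c ->]] /eqP/(frame_injP eF)[-> ->].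
  have e'O x0 : oframe (ofo A X) (fun i b => e' X x0 (e X (f i b))).
    have -> // : (fun i b => e' X x0 (e X (f i b))) = f.
    by apply/funext => i; apply/funext => b; apply: e'K.
  have h1 : is_ohom (eta X oX).
    apply: (@is_ohom_frame G _ _ (eta X oX) f oA oB fO eO) => [g z zS|z zS].
      exact: eG.
    exact: (chom_of_pi _ fF eF).
  have h2 : is_ohom (eps X oX).
    apply: (@is_ohom_frame G _ _ (eps X oX) _ oB oA eO) => [|g z zS|z zS].
      exact: e'O.
      have [[[aS _ _ _] _ _ _ _] _] := ofunctor_cov HA oX.
      have [i [b ->]] := eS' _ zS; rewrite /= -eG // e'K.
      by have [j [c ->]] := fS' _ (aS g _ (fS i b)); rewrite e'K.
    exact: (chom_of_pi _ eF (proj1 (e'O _)) zS).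
  split=> //; apply: chom_eqZ.
  + exact: ofunctor_cov.
  + by case: (is_ohom_comp h1 h2).
  + by case: (is_ohom_id (ofo A X)).
  + by move=> z /fS'[i [b ->]] /=; rewrite e'K.
  + exact: ofunctor_cov.
  + by case: (is_ohom_comp h2 h1).
  + by case: (is_ohom_id (ofo B X)).
  + by move=> z /eS'[i [b ->]] /=; rewrite e'K.
exists eta, eps; split=> // X Y h oX oY hh.
have [h1 _ _ _] := inv X oX; have [k1 _ _ _] := inv Y oY.
have Ah := ofunctor_ohom HA oX oY hh; have Bh := ofunctor_ohom HB oX oY hh.
apply: chom_eqZ; first exact: ofunctor_cov.
- by case: (is_ohom_comp Ah k1).
- by case: (is_ohom_comp h1 Bh).
by move=> z zS /=; apply: enat.
Qed.

Lemma oid_functor : is_ofunctor (oid G).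
Proof. by split=> //= X oX; split. Qed.

(** The direct implication keeps ill-formed objects ill-formed under [kappa], so that the extended
    functors are the identity on both sides of the third equivalence there. *)
Lemma kappa_ocov X : is_ocov (ofo (kappa G) X) <-> is_ocov X.
Proof.
have sK : involutive swap2.
  by case=> [[|[|i]] Hi] //; apply: val_inj.
split=> -[cX dS dI dO dG].
  split=> //.
  - by move=> i; rewrite -[i]sK; apply: dS.
  - by move=> i j; rewrite -[i]sK -[j]sK => /dI->.
  - by move=> O /dO[i <-]; exists (swap2 i).
  - by move=> g i; rewrite -[i]sK; apply: dG.
split=> //=.
- by move=> i j /dI/(can_inj sK).
- by move=> O /dO[i <-]; exists (swap2 i); rewrite /= sK.
Qed.

Lemma kappa_functor : is_ofunctor (kappa G).
Proof.
split=> //=.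
- by move=> X oX; apply/kappa_ocov.
- by move=> X Y h _ _ [hh hD]; split=> // i; apply: hD.
Qed.

End NaturalIsomorphisms.

(* [onatiso] also asks for morphism data at ill-formed objects, where there may
   be none (e.g. towards an empty carrier); hence the spinor functors are
   replaced by the identity there. *)
Section Extension.
Variable G : TopGroup.type.
Implicit Types (X Y : ocov G) (A B F : ofunctor G).

Definition const_chom (X Y : cov G) (y : gT (cZ Y)) : chom X Y :=
  @CHom G X Y (fun _ => y) (fun _ => cpi Y y).

Definition extend_obj F X : ocov G :=
  if pselect (is_ocov X) is left _ then ofo F X else X.

(** In the mixed cases a constant map is available: a well-formed target has a point, and a
    well-formed source has one that [h] sends into the target. *)
Definition extend_hom F (HF : is_ofunctor F) X Y
    (h : chom (ocov_base X) (ocov_base Y)) :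
    chom (ocov_base (extend_obj F X)) (ocov_base (extend_obj F Y)) :=
  match pselect (is_ocov X) as a, pselect (is_ocov Y) as b
    return chom (ocov_base (if a is left _ then ofo F X else X))
                (ocov_base (if b is left _ then ofo F Y else Y)) with
  | left _, left _ => ofh F h
  | left oX, right _ => const_chom _ (hZ h (ocov_point oX))
  | right _, left oY => const_chom _ (ocov_point (ofunctor_ocov HF oY))
  | right _, right _ => h
  end.

Definition extend F (HF : is_ofunctor F) : ofunctor G :=
  @OFunctor G (extend_obj F) (extend_hom HF).

Variables (F : ofunctor G) (HF : is_ofunctor F).

Lemma extend_functor : is_ofunctor (extend HF).
Proof.
have [F1 F2 F3 F4 F5] := HF.
split=> /=; rewrite /extend_hom /extend_obj.
- by move=> X; case: pselect => // oX _; apply: F1.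
- by move=> X Y h; case: pselect => // oX; case: pselect => // oY _ _; apply: F2.
- by move=> X Y h k; case: pselect => // oX; case: pselect => // oY _ _; apply: F3.
- by move=> X; case: pselect => // oX _; apply: F4.
- move=> X Y W h k; case: pselect => // oX; case: pselect => // oY.
  by case: pselect => // oW _ _ _; apply: F5.
Qed.

Lemma extend_forget_eq : cfunctor_eq (forget_after (extend HF)) (forget_after F).
Proof.
split=> /=; rewrite /extend_hom /extend_obj.
  by move=> X; case: pselect.
by move=> X Y h; case: pselect => // oX; case: pselect.
Qed.

Lemma extend_junk X : ~ is_ocov X -> ofo (extend HF) X = X.
Proof. by rewrite /= /extend_obj; case: pselect. Qed.

Lemma extend_natiso : natiso_on (extend HF) F.
Proof.
have [F1 F2 F3 F4 F5] := HF.
pose T X := (chom (ocov_base (extend_obj F X)) (ocov_base (ofo F X)) *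
             chom (ocov_base (ofo F X)) (ocov_base (extend_obj F X)))%type.
(* The return clause abstracts the outcome of [pselect]; on a well-formed object both sides are [F],
   and identities serve in both directions. *)
pose t X (oX : is_ocov X) : T X :=
  match pselect (is_ocov X) as a return
    (chom (ocov_base (if a is left _ then ofo F X else X)) (ocov_base (ofo F X)) *
     chom (ocov_base (ofo F X)) (ocov_base (if a is left _ then ofo F X else X)))%type
  with left _ => (Defs.cid _, Defs.cid _) | right n => False_rect _ (n oX) end.
exists (fun X oX => (t X oX).1), (fun X oX => (t X oX).2); split.
  move=> X oX; rewrite /t /= /extend_obj; case: pselect => // o /=.
  by split=> //; apply: is_ohom_id.
move=> X Y h oX oY hh; rewrite /t /= /extend_hom /extend_obj.
by case: pselect => // o; case: pselect.
Qed.

End Extension.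

(** * Triality *)

Section Triality.
Variable G : TopGroup.type.
Implicit Types (X Y : ocov G).

(** At ill-formed objects the identity, transported along the equality of coverings, fills in the
    missing components. *)
Lemma onatiso_of A B : @natiso_on G A B ->
  (forall X, ~ is_ocov X -> ocov_base (ofo A X) = ocov_base (ofo B X)) ->
  onatiso A B.
Proof.
move=> [eta [eps [inv nat]]] eAB.
pose cast (X Y : cov G) (e : X = Y) : chom X Y :=
  match e in _ = Y return chom X Y with erefl => Defs.cid X end.
exists (fun X => match pselect (is_ocov X) with
  | left oX => eta X oX | right n => cast _ _ (eAB X n) end).
exists (fun X => match pselect (is_ocov X) with
  | left oX => eps X oX | right n => cast _ _ (esym (eAB X n)) end).
split=> [X oX|X Y h oX oY hh]; first by case: pselect.
by case: pselect => // oX'; case: pselect => // oY'; apply: nat.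
Qed.

Let D c := ospinF G c.
Let HD c : is_ofunctor (D c) := ospinF_functor G c.

Lemma agree_addcC v w b : agree v (addc w b) = agree (addc v b) w.
Proof. by case: b v w => [] [[[[] []] []] []] [[[[] []] []] []]. Qed.

(** [D false] puts the label 1 on the class of the sections [Ssec false w] with [w] in the second
    spinor set, so its first spinor set is a copy of that set. *)
Lemma spin2_natiso : natiso_on (D true) (ocomp (D false) (D false)).
Proof.
have HC := ocomp_functor (HD false) (HD false).
apply: (@natiso_on_frames G _ _ (HD true) HC
  (fun X w => (Ssec false w : gT (cZ (ocov_base (ofo (ocomp (D false) (D false)) X)))))).
- move=> X oX; have [f fO] := ocov_oframe oX.
  exists (spin_frame f (spin_mx true)); split; first exact: spin_oframe (spin_mxP true).
  (* Row [j] holds the coordinates of [Ssec] of row [j] of [spin_mx true]; being a spin matrix is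
     then a computation. *)
  pose N j := mkbits (fun i => agree (spin_mx false i) (spin_mx true j) != 3).
  have NP : spin_matrix false N by apply: spin_matrixP; vm_compute.
  have := spin_oframe (spin_oframe fO (spin_mxP false)) NP.
  set F := spin_frame _ N; set F' := (fun i b => _); suff -> : F = F' by [].
  apply/funext => j; apply/funext => b; rewrite /F /F' /spin_frame.
  have [Np _ _ _ _] := spin_mxP true.
  rewrite (Ssec_frame fO (spin_mxP false)); last by rewrite par_addc Np.
  congr sec; apply: bits_ext => i; rewrite bit_addc !bit_mkbits.
  have [Np' _ _ _ _] := spin_mxP false.
  rewrite agree_addcC agree_addc; last by rewrite Np Np'.
  by case: b; case: (agree _ _ == 3).
- move=> X g oX w wS; have [f fO] := ocov_oframe oX.
  exact/esym/(Ssec_image fO (gact_oframe g oX fO)).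
- move=> X Y h oX oY hh w wS; have [f fO] := ocov_oframe oX.
  exact/esym/(Ssec_image fO (ohom_oframe oX oY hh fO)).
Qed.

(** [D true] puts the label 1 on the class of the sections coming from points of the original
    covering, so its first spinor set gives back these points. *)
Lemma spin3_natiso : natiso_on (oid G) (ocomp (D false) (D true)).
Proof.
have HC := ocomp_functor (HD false) (HD true).
apply: (@natiso_on_frames G _ _ (oid_functor G) HC
  (fun X z => (Zsec true (X := X) z :
     gT (cZ (ocov_base (ofo (ocomp (D false) (D true)) X)))))).
- move=> X oX; have [f fO] := ocov_oframe oX; exists f; split=> //.
  (* By [Zsec_frame] the matrix needed is the transpose of [spin_mx true]. *)
  pose N k := mkbits (fun j => bit (spin_mx true j) k).
  have NP : spin_matrix false N by apply: spin_matrixP; vm_compute.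
  have := spin_oframe (spin_oframe fO (spin_mxP true)) NP.
  set F := spin_frame _ N; set F' := (fun i b => _); suff -> : F = F' by [].
  by apply/funext => j; apply/funext => b; rewrite /F' (Zsec_frame fO (spin_mxP true)).
- move=> X g oX w wS; have [f fO] := ocov_oframe oX.
  exact/esym/(Zsec_image fO (gact_oframe g oX fO)).
- move=> X Y h oX oY hh w wS; have [f fO] := ocov_oframe oX.
  exact/esym/(Zsec_image fO (ohom_oframe oX oY hh fO)).
Qed.

Lemma spin_kappa_natiso :
  natiso_on (ocomp (D false) (kappa G)) (ocomp (kappa G) (D true)).
Proof.
have H1 := ocomp_functor (HD false) (kappa_functor G).
have H2 := ocomp_functor (kappa_functor G) (HD true).
(* Both sides have the same underlying covering by conversion, so the isomorphism is the identity
   and only the labels need comparing. *)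
have del X j : odel (ospin false (ofo (kappa G) X)) j = odel (ospin true X) (swap2 j).
  by case: (b2oP j) => -[] ->.
apply: (@natiso_on_frames G _ _ H1 H2
  (fun X (w : gT (cZ (ocov_base (ofo (ocomp (D false) (kappa G)) X)))) =>
     (w : gT (cZ (ocov_base (ofo (ocomp (kappa G) (D true)) X)))))).
- move=> X oX; have [f fO] := ocov_oframe (ofunctor_ocov H1 oX).
  exists f; split=> //; case: fO => fF fd; split; first exact: fF.
  by move=> v; rewrite fd; exact: del.
- by [].
- by [].
Qed.

Let C c := extend (HD c).

Lemma triality_functors :
    [/\ is_ofunctor (C false), is_ofunctor (C true),
        cfunctor_eq (forget_after (C false)) (Cspin G ord0) &
        cfunctor_eq (forget_after (C true)) (Cspin G ord_max)] /\
    [/\ onatiso (ocomp (C false) (ocomp (C false) (C false))) (oid G),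
        onatiso (ocomp (C false) (C false)) (C true) &
        onatiso (ocomp (C false) (kappa G)) (ocomp (kappa G) (C true))].
Proof.
have HC c : is_ofunctor (C c) := extend_functor (HD c).
have HK := kappa_functor G.
have CD c : natiso_on (C c) (D c) := extend_natiso (HD c).
(* The extended functors are replaced by the plain ones one factor at a time. *)
have CC c c' : natiso_on (ocomp (C c) (C c')) (ocomp (D c) (D c')).
  apply: (@natiso_on_trans _ _ (ocomp (D c) (C c'))); try exact: ocomp_functor.
    exact: natiso_on_compr.
  exact: natiso_on_compl.
have J X c : ~ is_ocov X -> extend_obj (D c) X = X by apply: (extend_junk (HD c)).
have C2 : natiso_on (ocomp (C false) (C false)) (C true).
  apply: (natiso_on_trans _ _ _ (CC _ _)); try exact: ocomp_functor; first exact: HC.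
  apply: (@natiso_on_trans _ _ (D true)); rewrite //; try exact: ocomp_functor.
    by apply: natiso_on_sym spin2_natiso => //; apply: ocomp_functor.
  exact: natiso_on_sym.
split; split.
- exact: HC.
- exact: HC.
- exact: (extend_forget_eq (HD false)).
- exact: (extend_forget_eq (HD true)).
- apply: onatiso_of => [|X nX]; last by rewrite /= !J.
  (* Two of the three factors merge by [C2], and [spin3_natiso] disposes of the resulting
     composite. *)
  apply: (@natiso_on_trans _ _ (ocomp (C false) (C true)));
    do ?[exact: ocomp_functor | exact: oid_functor | apply: ocomp_functor => //].
    by apply: natiso_on_compl => //; apply: ocomp_functor.
  apply: (natiso_on_trans _ _ _ (CC _ _)); try exact: ocomp_functor; first exact: oid_functor.
  by apply: natiso_on_sym spin3_natiso; [exact: oid_functor|exact: ocomp_functor].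
- by apply: onatiso_of => // X nX; rewrite /= !J.
- apply: onatiso_of => [|X nX]; last first.
    have nK : ~ is_ocov (ofo (kappa G) X) by move/kappa_ocov.
    by rewrite /= (J _ _ nK) (J _ _ nX).
  apply: (@natiso_on_trans _ _ (ocomp (D false) (kappa G))); try exact: ocomp_functor.
    exact: natiso_on_compr.
  apply: (@natiso_on_trans _ _ (ocomp (kappa G) (D true))); try exact: ocomp_functor.
    exact: spin_kappa_natiso.
  by apply: natiso_on_compl => //; apply: natiso_on_sym.
Qed.

End Triality.

Theorem theorem4p1 (G : TopGroup.type) (HG : profinite G) :
  exists C1p C2p : ofunctor G,
    [/\ is_ofunctor C1p, is_ofunctor C2p,
        cfunctor_eq (forget_after C1p) (Cspin G ord0) &
        cfunctor_eq (forget_after C2p) (Cspin G ord_max)] /\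
    [/\ onatiso (ocomp C1p (ocomp C1p C1p)) (oid G),
        onatiso (ocomp C1p C1p) C2p &
        onatiso (ocomp C1p (kappa G)) (ocomp (kappa G) C2p)].
Proof.
exists (extend (ospinF_functor G false)), (extend (ospinF_functor G true)).
exact: triality_functors.
Qed.
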